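(* Let $\mathcal{A}=\varinjlim(\mathcal{A}_i,\varphi_i)$ be a strongly maximal TAF algebra. If $a\in\mathcal{A}$, then $$\|a\|=\sup\{\|\rho(a)\| : \rho\text{ is a contractive essential nest representation of }\mathcal{A}\}.$$
   Context: Strongly maximal TAF algebra: for each $i\in\mathbb{N}$, let $\mathfrak{A}_i$ be a finite direct sum of full complex matrix algebras and $\mathcal{A}_i\subseteq\mathfrak{A}_i$ the corresponding direct sum of the upper triangular matrix subalgebras. Let $\varphi_i:\mathfrak{A}_i\to\mathfrak{A}_{i+1}$ be an injective $*$-homomorphism with $\varphi_i(\mathcal{A}_i)\subseteq\mathcal{A}_{i+1}$ (the embedding of $\mathcal{A}_i$ is $*$-extendable) which is regular, i.e. maps each matrix unit to a sum of matrix units. Then $\mathcal{A}=\varinjlim(\mathcal{A}_i,\varphi_i)$ is the norm closure of $\bigcup_i\mathcal{A}_i$ inside the AF C*-algebra $\mathfrak{A}=\varinjlim(\mathfrak{A}_i,\varphi_i)$, with the norm inherited from $\mathfrak{A}$. Nest representation: a representation is a bounded algebra homomorphism $\rho:\mathcal{A}\to B(\mathcal{H})$, $\mathcal{H}$ a Hilbert space; it is a nest representation if the lattice $\mathcal{N}=\operatorname{Lat}\rho(\mathcal{A})$ of closed $\rho(\mathcal{A})$-invariant subspaces is linearly ordered, i.e. a nest. It is contractive if $\|\rho(a)\|\le\|a\|$ for all $a$. $0_+$ is the minimal non-zero element of $\mathcal{N}$ (with $0_+=0$ if none exists); $I_-$ is the largest element of $\mathcal{N}$ different from $I$, i.e.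 from $\mathcal{H}$ (with $I_-=I$ if none exists). Essential nest representation: a nest representation $\rho$ with nest $\mathcal{N}$ is essential if (i) $\dim 0_+=\dim I_-^{\perp}=1$, and (ii) the rank one operator from $I_-^{\perp}$ into $0_+$ (i.e. $x\mapsto\langle x,h\rangle g$ with $0_+=[g]$, $I_-^\perp=[h]$, where $[\cdot]$ denotes linear span) belongs to $\rho(\mathcal{A})$. *)

(* Defs.v *)
From HB Require Import structures.
From mathcomp Require Import all_boot all_order all_algebra.
From mathcomp Require Import complex.
From mathcomp Require Import all_classical all_reals all_analysis.

Set Implicit Arguments.
Unset Strict Implicit.
Unset Printing Implicit Defensive.

Import Order.TTheory GRing.Theory Num.Theory.
Import numFieldNormedType.Exports.

Local Open Scope classical_set_scope.
Local Open Scope ring_scope.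

(* Norms on normedModType R[i] are R[i]-valued (real and nonnegative); [rnorm]
   is the same norm read in R. *)
Definition rnorm (R : realType) (V : normedModType R[i]) (v : V) : R :=
  complex.Re `|v|.

(* Algebras are not assumed unital: the connecting maps of an inductive system
   need not preserve units, so the limit may have none. *)
HB.mixin Record isStarAlg (R : realType) A of GRing.Lmodule R[i] A := {
  amul : A -> A -> A;
  astar : A -> A;
  amulA : associative amul;
  amul_linearl : forall (c : R[i]) (x y z : A),
    amul (c *: x + y) z = c *: amul x z + amul y z;
  amul_linearr : forall (c : R[i]) (x y z : A),
    amul x (c *: y + z) = c *: amul x y + amul x z;
  astar_antilinear : forall (c : R[i]) (x y : A),
    astar (c *: x + y) = Num.conj c *: astar x + astar y;
  astarM : forall x y : A, astar (amul x y) = amul (astar y) (astar x);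
  astarK : involutive astar
}.

#[short(type="starAlgType")]
HB.structure Definition StarAlg (R : realType) :=
  { A of GRing.Lmodule R[i] A & isStarAlg R A }.

HB.mixin Record isCStar (R : realType) A
    of StarAlg R A & CompleteNormedModule R[i] A := {
  cstar_normM : forall x y : A, `|amul x y| <= `|x| * `|y|;
  cstar_norm : forall x : A, `|amul (astar x) x| = `|x| ^+ 2
}.

#[short(type="cstarAlgType")]
HB.structure Definition CStarAlg (R : realType) :=
  { A of StarAlg R A & CompleteNormedModule R[i] A & isCStar R A }.

Definition star_hom (R : realType) (A B : starAlgType R)
    (f : {linear A -> B}) : Prop :=
  (forall x y, f (amul x y) = amul (f x) (f y)) /\
  (forall x, f (astar x) = astar (f x)).

(* M_{n_0 + 1}(C) (+) ... (+) M_{n_k + 1}(C): the successors make the number of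
   summands and their sizes positive. *)
Definition fdalg (R : realType) (k : nat) (n : 'I_k.+1 -> nat) :=
  {dffun forall j : 'I_k.+1, 'M[R[i]]_((n j).+1)}.

Section FiniteDimensional.
Variables (R : realType) (k : nat) (n : 'I_k.+1 -> nat).
Local Notation C := R[i].
Local Notation F := (fdalg R n).
Implicit Types x y z : F.

HB.instance Definition _ := Choice.on F.

Definition fd_zero : F := [ffun j => 0].
Definition fd_add x y : F := [ffun j => x j + y j].
Definition fd_opp x : F := [ffun j => - x j].
Definition fd_scale (c : C) x : F := [ffun j => c *: x j].
Definition fd_mul x y : F := [ffun j => x j *m y j].
Definition fd_star x : F := [ffun j => map_mx Num.conj (x j)^T].

Fact fd_addA : associative fd_add.
Proof. by move=> x y z; apply/ffunP => j; rewrite !ffunE addrA. Qed.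
Fact fd_addC : commutative fd_add.
Proof. by move=> x y; apply/ffunP => j; rewrite !ffunE addrC. Qed.
Fact fd_add0 : left_id fd_zero fd_add.
Proof. by move=> x; apply/ffunP => j; rewrite !ffunE add0r. Qed.
Fact fd_addN : left_inverse fd_zero fd_opp fd_add.
Proof. by move=> x; apply/ffunP => j; rewrite !ffunE addNr. Qed.

HB.instance Definition _ :=
  GRing.isZmodule.Build F fd_addA fd_addC fd_add0 fd_addN.

Fact fd_scaleA (a b : C) x : fd_scale a (fd_scale b x) = fd_scale (a * b) x.
Proof. by apply/ffunP => j; rewrite !ffunE scalerA. Qed.
Fact fd_scale1 : left_id 1 fd_scale.
Proof. by move=> x; apply/ffunP => j; rewrite !ffunE scale1r. Qed.
Fact fd_scaleDr : right_distributive fd_scale +%R.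
Proof. by move=> a x y; apply/ffunP => j; rewrite !ffunE scalerDr. Qed.
Fact fd_scaleDl x : {morph fd_scale^~ x : a b / a + b}.
Proof. by move=> a b; apply/ffunP => j; rewrite !ffunE scalerDl. Qed.

HB.instance Definition _ :=
  GRing.Zmodule_isLmodule.Build C F fd_scaleA fd_scale1 fd_scaleDr fd_scaleDl.

Fact fd_mulA : associative fd_mul.
Proof. by move=> x y z; apply/ffunP => j; rewrite !ffunE mulmxA. Qed.
Fact fd_mul_linearl (c : C) x y z :
  fd_mul (c *: x + y) z = c *: fd_mul x z + fd_mul y z.
Proof. by apply/ffunP => j; rewrite !ffunE mulmxDl scalemxAl. Qed.
Fact fd_mul_linearr (c : C) x y z :
  fd_mul x (c *: y + z) = c *: fd_mul x y + fd_mul x z.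
Proof. by apply/ffunP => j; rewrite !ffunE mulmxDr scalemxAr. Qed.
Fact fd_star_antilinear (c : C) x y :
  fd_star (c *: x + y) = Num.conj c *: fd_star x + fd_star y.
Proof. by apply/ffunP => j; apply/matrixP => p q; rewrite !ffunE !mxE rmorphD rmorphM. Qed.
Fact fd_starM x y : fd_star (fd_mul x y) = fd_mul (fd_star y) (fd_star x).
Proof. by apply/ffunP => j; rewrite !ffunE trmx_mul map_mxM. Qed.
Fact fd_starK : involutive fd_star.
Proof.
by move=> x; apply/ffunP => j; apply/matrixP => p q; rewrite !ffunE !mxE conjCK.
Qed.

HB.instance Definition _ := isStarAlg.Build R F fd_mulA fd_mul_linearl
  fd_mul_linearr fd_star_antilinear fd_starM fd_starK.

Definition munit_idx := {j : 'I_k.+1 & ('I_(n j).+1 * 'I_(n j).+1)%type}.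

(* [munit (Tagged _ (p, q))], with tag j, is the matrix unit e_{pq} of the j-th
   summand. *)
Definition munit (u : munit_idx) : F :=
  [ffun j => \matrix_(p, q)
    (Tagged (fun j => ('I_(n j).+1 * 'I_(n j).+1)%type) (p, q) == u)%:R].

Definition upper_triangular : set F :=
  [set x : F | forall (j : 'I_k.+1) (p q : 'I_(n j).+1), (q < p)%N -> x j p q = 0].

End FiniteDimensional.

Definition regular (R : realType) (k l : nat) (n : 'I_k.+1 -> nat)
    (m : 'I_l.+1 -> nat) (f : fdalg R n -> fdalg R m) : Prop :=
  forall u : munit_idx n, exists S : {set munit_idx m},
    f (munit R u) = \sum_(v in S) munit R v.

Definition TAF_embedding (R : realType) (k l : nat) (n : 'I_k.+1 -> nat)
    (m : 'I_l.+1 -> nat) (f : {linear fdalg R n -> fdalg R m}) : Prop :=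
  [/\ star_hom f, injective f,
      f @` @upper_triangular R k n `<=` @upper_triangular R l m & regular f].

(* The C*-algebra A, with canonical maps psi, is the inductive limit of the
   system phi of injective star-homomorphisms: the completion of the increasing
   union of the psi_i(A_i).  No norm on A_i has to be prescribed, since a finite
   dimensional star-algebra carries at most one C*-norm. *)
Definition is_AF_limit (R : realType) (k : nat -> nat)
    (n : forall i, 'I_(k i).+1 -> nat)
    (phi : forall i, {linear fdalg R (n i) -> fdalg R (n i.+1)})
    (A : cstarAlgType R) (psi : forall i, {linear fdalg R (n i) -> A}) : Prop :=
  [/\ forall i, star_hom (psi i),
      forall i, injective (psi i),
      forall i x, psi i.+1 (phi i x) = psi i x &
      closure (\bigcup_i range (psi i)) = [set: A]].

Definition TAF_algebra (R : realType) (k : nat -> nat)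
    (n : forall i, 'I_(k i).+1 -> nat)
    (A : cstarAlgType R) (psi : forall i, {linear fdalg R (n i) -> A}) : set A :=
  closure (\bigcup_i (psi i @` @upper_triangular R (k i) (n i))).

(* The inner product is linear in its first argument. *)
HB.mixin Record isHilbert (R : realType) H of CompleteNormedModule R[i] H := {
  hdot : {dot H for Num.conj};
  hdotE : forall x : H, hdot x x = `|x| ^+ 2
}.

#[short(type="hilbertType")]
HB.structure Definition Hilbert (R : realType) :=
  { H of CompleteNormedModule R[i] H & isHilbert R H }.

Section Operators.
Variables (R : realType) (H : hilbertType R).
Implicit Types (M L : set H) (T : H -> H).

Definition opnorm T : \bar R :=
  ereal_sup [set (rnorm (T x))%:E | x in [set x | rnorm x <= 1]].

Definition orthocompl M : set H := [set x | forall y, M y -> hdot x y = 0].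

Definition line (g : H) : set H := [set c *: g | c in [set: R[i]]].

Definition rank_one (g h : H) : H -> H := fun x => hdot x h *: g.

Definition closed_subspace M : Prop :=
  [/\ M 0, forall (c : R[i]) x y, M x -> M y -> M (c *: x + y) & closed M].

Definition Lat (S : set (H -> H)) : set (set H) :=
  [set M | closed_subspace M /\ forall T, S T -> T @` M `<=` M].

Definition is_chain (N : set (set H)) : Prop :=
  forall M L, N M -> N L -> M `<=` L \/ L `<=` M.

Definition zero_plus (N : set (set H)) : set H :=
  xget [set 0] [set M | [/\ N M, M <> [set 0] &
    forall L, N L -> L <> [set 0] -> L `<=` M -> L = M]].

Definition I_minus (N : set (set H)) : set H :=
  xget [set: H] [set M | [/\ N M, M <> [set: H] &
    forall L, N L -> L <> [set: H] -> L `<=` M]].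

End Operators.

(* The algebra is a set [B] of elements of an ambient C*-algebra [A]; a map on
   [B] is given as a map on [A], of which only the restriction to [B] is used. *)
Section Representations.
Variables (R : realType) (A : cstarAlgType R) (B : set A) (H : hilbertType R).
Variable rho : A -> {linear H -> H}.

Definition rep_image : set (H -> H) := [set (rho a : H -> H) | a in B].

Definition is_representation : Prop :=
  [/\ forall (c : R[i]) a b x, B a -> B b ->
        rho (c *: a + b) x = c *: rho a x + rho b x,
      forall a b x, B a -> B b -> rho (amul a b) x = rho a (rho b x) &
      exists K : R, forall a, B a -> (opnorm (rho a) <= (K * rnorm a)%:E)%E].

Definition contractive : Prop :=
  forall a, B a -> (opnorm (rho a) <= (rnorm a)%:E)%E.

Definition nest_representation : Prop :=
  is_representation /\ is_chain (Lat rep_image).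

Definition essential_nest_representation : Prop :=
  nest_representation /\
  exists g h : H, [/\ g != 0, h != 0,
    zero_plus (Lat rep_image) = line g,
    orthocompl (I_minus (Lat rep_image)) = line h &
    rep_image (rank_one g h)].

End Representations.

(* Main.v *)
Require Import Defs.
From HB Require Import structures.
From mathcomp Require Import all_boot all_order all_algebra.
From mathcomp Require Import complex.
From mathcomp Require Import all_classical all_reals all_analysis.
From mathcomp Require Import ring lra zify.

(* Fix a finite level, a summand of it and the corner matrix unit e of that
   summand.  The images of e at the later levels are sums of matrix units; among
   the intervals [p, q] spanned by these, the inclusion-minimal ones form an
   infinite, finitely branching tree, so Koenig's lemma gives a coherent sequence
   of minimal intervals.  Their union is a countable linearly ordered set with a
   least and a greatest element, on which the algebra acts by the compression of
   its matrices to the intervals.  For upper triangular matrices these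
   compressions are multiplicative and block diagonal with respect to the
   growing intervals, so they define a contractive representation on l2 of the
   union.  Matrix units compressed at higher and higher levels converge strongly
   to rank one matrix units; hence the invariant subspaces are those spanned by
   the initial segments, and minimality makes the image of e exactly the rank one
   operator from the last basis vector to the first.  The compression to the
   initial level is the summand one started with, so the norm is attained up to
   epsilon because an injective *-homomorphism of a finite dimensional algebra is
   isometric. *)

Set Implicit Arguments.
Unset Strict Implicit.
Unset Printing Implicit Defensive.

Import Order.TTheory GRing.Theory Num.Theory.
Import numFieldNormedType.Exports.

Local Open Scope classical_set_scope.
Local Open Scope ring_scope.

(** * The Hilbert space l2 *)

(** Intervals are needed because entry (a, b) of a product of upper triangular matrices involves
    only the indices between a and b: cutting down to an interval is multiplicative there, though
    not on full matrices. Block diagonality comes from regularity. A matrix unit of the next level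
    lies in the image of at most one matrix unit, so the new indices split into copies of the old
    summands, plus leftovers. The next interval has both ends in one such copy; its further indices
    lie outside that copy, and rows and columns of the image of x do not mix the two.

    The norm of the ambient algebra is known only through its axioms. Both comparisons with operator
    norms on vectors start from crude bounds with dimensional constants, applied to the iterates of
    x -> x* x; the C*-identity turns norms into exact powers, and the constants vanish under 2^i-th
    roots. No spectral theory enters.

    A representation reproduces faithfully only the chosen summand of its starting level. An element
    of level m is therefore treated by discarding the first m levels, and a general element by
    approximation. *)

Section SquaredModulus.
Variable R : realType.
Implicit Types x y z : R[i].

(** The squared modulus taken in R, so that estimates stay in an ordered field where [nra] and real
    series apply, instead of using the R[i]-valued norm. *)
Definition csq z : R := complex.Re z ^+ 2 + complex.Im z ^+ 2.

Lemma csq_ge0 z : 0 <= csq z.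
Proof. by rewrite addr_ge0 ?sqr_ge0. Qed.

Lemma csqE z : (csq z)%:C%C = `|z| ^+ 2.
Proof. exact: add_Re2_Im2. Qed.

Lemma csq0 : csq 0 = 0.
Proof. by rewrite /csq /= expr0n /= addr0. Qed.

Lemma csq1 : csq 1 = 1.
Proof. by rewrite /csq /= expr0n /= expr1n addr0. Qed.

Lemma csqM x y : csq (x * y) = csq x * csq y.
Proof. by apply: complexI; rewrite rmorphM /= !csqE normrM exprMn. Qed.

Lemma csqD x y : csq (x + y) <= 2 * csq x + 2 * csq y.
Proof.
case: x y => [a b] [c d]; rewrite /csq /=.
have := sqr_ge0 (a - c); have := sqr_ge0 (b - d); nra.
Qed.

Lemma csqN x : csq (- x) = csq x.
Proof. by case: x => a b; rewrite /csq /= !sqrrN. Qed.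

Lemma csq_conj x : csq (Num.conj x) = csq x.
Proof. by case: x => a b; rewrite /csq /= !sqrrN. Qed.

Lemma mulCconj x : x * Num.conj x = (csq x)%:C%C.
Proof. by rewrite csqE normCK. Qed.

Lemma csq_eq0 z : (csq z == 0) = (z == 0).
Proof.
by rewrite -(inj_eq (@complexI R)) csqE expf_eq0 /= normr_eq0.
Qed.

Lemma RRe_ge0 z : 0 <= z -> (complex.Re z)%:C%C = z.
Proof. by move=> z0; rewrite RRe_real // ger0_real. Qed.

(** Follows from the squares (a - c)^2, (a + c)^2, (b - d)^2, (b + d)^2. The optimal factor 1/2 is
    dropped: the bound only serves to make inner product series summable. *)
Lemma ReM_abs x y : `|complex.Re (x * y)| <= csq x + csq y.
Proof.
case: x y => [a b] [c d]; rewrite /csq /= ler_norml.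
by have := sqr_ge0 (a - c); have := sqr_ge0 (b - d); have := sqr_ge0 (a + c);
   have := sqr_ge0 (b + d); move=> *; apply/andP; split; nra.
Qed.

Lemma ImM_abs x y : `|complex.Im (x * y)| <= csq x + csq y.
Proof.
case: x y => [a b] [c d]; rewrite /csq /= ler_norml.
by have := sqr_ge0 (a - d); have := sqr_ge0 (b - c); have := sqr_ge0 (a + d);
   have := sqr_ge0 (b + c); move=> *; apply/andP; split; nra.
Qed.

End SquaredModulus.

Section AbsolutelySummable.
Variable R : realType.

Definition abs_summable (u : nat -> R) : Prop :=
  exists K : R, forall N, \sum_(i < N) `|u i| <= K.

Definition rsum (u : nat -> R) : R := limn (series u).

Lemma abs_summable_cvg u : abs_summable u -> cvgn (series u).
Proof.
move=> [K uK]; apply: normed_cvg.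
apply: nondecreasing_is_cvgn.
  by apply: nondecreasing_series => i _ _; apply: normr_ge0.
by exists K => _ [N _ <-]; have := uK N; rewrite -(big_mkord xpredT (fun i => `|u i|)).
Qed.

Lemma abs_summableP a u v : abs_summable u -> abs_summable v ->
  abs_summable (fun i => a * u i + v i).
Proof.
move=> [K uK] [L vL]; exists (`|a| * K + L) => N.
apply: (@le_trans _ _ (\sum_(i < N) (`|a| * `|u i| + `|v i|))).
  by apply: ler_sum => i _; rewrite -normrM ler_normD.
rewrite big_split /= -mulr_sumr; apply: lerD (vL N).
by rewrite ler_wpM2l ?uK.
Qed.

Lemma rsumP a u v : abs_summable u -> abs_summable v ->
  rsum (fun i => a * u i + v i) = a * rsum u + rsum v.
Proof.
move=> /abs_summable_cvg cu /abs_summable_cvg cv; apply/cvg_lim => //.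
have -> : series (fun i => a * u i + v i) = a *: series u + series v.
  apply/funext => N; rewrite /series /= big_split /= -mulr_sumr.
  by rewrite !fctE.
by apply: cvgD => //; apply: cvgZr.
Qed.

Lemma rsumN u : abs_summable u -> rsum (fun i => - u i) = - rsum u.
Proof.
move=> su; have s0 : abs_summable (fun=> 0).
  by exists 0 => N; rewrite big1 // => i _; rewrite normr0.
have := rsumP (-1) su s0.
have -> : rsum (fun=> 0) = 0.
  apply/cvg_lim => //; have -> : series (fun=> 0 : R) = fun=> 0.
    by apply/funext => N; rewrite /series /= big1.
  exact: cvg_cst.
by rewrite addr0 mulN1r => <-; congr rsum; apply/funext => i; rewrite addr0 mulN1r.
Qed.

Lemma rsum_ge_part u N : abs_summable u -> (forall i, 0 <= u i) ->
  \sum_(i < N) u i <= rsum u.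
Proof.
move=> /abs_summable_cvg cu u0.
have -> : \sum_(i < N) u i = series u N by rewrite /series /= big_mkord.
by apply: nondecreasing_cvgn_le => //; apply: nondecreasing_series => i _ _.
Qed.

Lemma rsum_le u K : abs_summable u -> (forall N, \sum_(i < N) u i <= K) ->
  rsum u <= K.
Proof.
move=> /abs_summable_cvg cu uK; apply: limr_le => //.
by near=> N; rewrite /series /= big_mkord; apply: uK.
Unshelve. all: by end_near. Qed.

Lemma rsum_single k u : (forall i, i != k -> u i = 0) -> rsum u = u k.
Proof.
move=> uk; apply/cvg_lim => //; apply: cvg_near_cst.
near=> N; rewrite /series /= big_mkord.
have kN : (k < N)%N by near: N; exists k.+1.
rewrite (bigD1 (Ordinal kN)) //= big1 ?addr0 // => i ik.
exact: uk.
Unshelve. all: by end_near. Qed.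

Definition csummable (w : nat -> R[i]) : Prop :=
  abs_summable (fun i => complex.Re (w i)) /\
  abs_summable (fun i => complex.Im (w i)).

(** Real and imaginary parts are summed separately, so every convergence question concerns real
    series. *)
Definition csum (w : nat -> R[i]) : R[i] :=
  (rsum (fun i => complex.Re (w i)) +i* rsum (fun i => complex.Im (w i)))%C.

Lemma csumP a v w : csummable v -> csummable w ->
  csum (fun i => a * v i + w i) = a * csum v + csum w.
Proof.
case: a => a b [vr vi] [wr wi].
have si : abs_summable (fun i => - b * complex.Im (v i) + complex.Re (w i)).
  exact: abs_summableP.
have sr : abs_summable (fun i => b * complex.Re (v i) + complex.Im (w i)).
  exact: abs_summableP.
rewrite /csum; apply/eqP; rewrite eq_complex /=; apply/andP; split; apply/eqP.
  rewrite -addrA -mulNr -(rsumP (- b)) // -rsumP //; congr rsum.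
  apply/funext => i; case: (v i) (w i) => [p q] [s t] /=.
  by rewrite mulNr addrA.
rewrite -addrA -(rsumP b) // -rsumP //; congr rsum.
apply/funext => i; case: (v i) (w i) => [p q] [s t] /=; ring.
Qed.

Lemma csum_conj w : csummable w ->
  csum (fun i => Num.conj (w i)) = Num.conj (csum w).
Proof.
move=> [wr wi]; rewrite /csum /=; congr Complex.
  by congr rsum; apply/funext => i; case: (w i).
by rewrite -rsumN //; congr rsum; apply/funext => i; case: (w i).
Qed.

End AbsolutelySummable.

Section SquareSummable.
Variables (R : realType) (D : set nat).

Definition sqsum (f : nat -> R[i]) N : R := \sum_(i < N) csq (f i).

(** Sequences on all of [nat] that vanish off [D]: one type covers finite and infinite index sets,
    and boundedness is tested on prefix sums only. *)
Definition l2_pred : {pred nat -> R[i]} :=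
  fun f => `[< (forall i, ~ D i -> f i = 0) /\ exists K, forall N, sqsum f N <= K >].

Lemma l2_predP (f : nat -> R[i]) : reflect
  ((forall i, ~ D i -> f i = 0) /\ exists K, forall N, sqsum f N <= K)
  (f \in l2_pred).
Proof. exact: asboolP. Qed.

Fact l2_submod : GRing.submod_closed l2_pred.
Proof.
split.
  apply/l2_predP; split=> //; exists 0 => N.
  by rewrite /sqsum big1 // => i _; rewrite csq0.
move=> a f g /l2_predP[f0 [K fK]] /l2_predP[g0 [L gL]].
apply/l2_predP; split=> [i Di|]; first by rewrite !fctE f0 // g0 // scaler0 addr0.
exists (2 * csq a * K + 2 * L) => N; rewrite /sqsum.
apply: (@le_trans _ _ (\sum_(i < N) (2 * csq a * csq (f i) + 2 * csq (g i)))).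
  by apply: ler_sum => i _; rewrite !fctE (le_trans (csqD _ _)) // csqM mulrA.
rewrite big_split /= -!mulr_sumr lerD ?ler_wpM2l ?mulr_ge0 ?csq_ge0 //.
- exact: fK.
- exact: gL.
Qed.

HB.instance Definition _ := GRing.isSubmodClosed.Build R[i] (nat -> R[i]) l2_pred
  l2_submod.

Record l2 := L2 { l2_fun :> nat -> R[i]; _ : l2_fun \in l2_pred }.
HB.instance Definition _ := [isSub for l2_fun].
HB.instance Definition _ := [Choice of l2 by <:].
HB.instance Definition _ := [SubChoice_isSubLmodule of l2 by <:].

Implicit Types x y z : l2.

Lemma l2E (c : R[i]) x y i : (c *: x + y) i = c * x i + y i.
Proof. by []. Qed.
Lemma l2DE x y i : (x + y) i = x i + y i.
Proof. by []. Qed.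
Lemma l2NE x i : (- x) i = - x i.
Proof. by []. Qed.
Lemma l2ZE (c : R[i]) x i : (c *: x) i = c * x i.
Proof. by []. Qed.
Lemma l20E i : (0 : l2) i = 0.
Proof. by []. Qed.

Lemma l2_bounded x : exists K, forall N, sqsum x N <= K.
Proof. by case: x => f /= /l2_predP[]. Qed.

Lemma l2_supp x i : ~ D i -> x i = 0.
Proof. by case: x => f /= /l2_predP[+ _]; apply. Qed.

Lemma l2P x y : (forall i, x i = y i) -> x = y.
Proof. by move=> xy; apply/val_inj/funext. Qed.

Lemma sqsum_summable x : abs_summable (fun i => csq (x i)).
Proof.
have [K xK] := l2_bounded x; exists K => N; apply: le_trans (xK N).
by apply: ler_sum => i _; rewrite ger0_norm // csq_ge0.
Qed.

Lemma csummable_dot x y : csummable (fun i => x i * Num.conj (y i)).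
Proof.
have [K xK] := l2_bounded x; have [L yL] := l2_bounded y.
have xyKL N : \sum_(i < N) (csq (x i) + csq (y i)) <= K + L.
  by rewrite big_split /= lerD; [|exact: xK|exact: yL].
split; exists (K + L) => N; apply: le_trans (xyKL N); apply: ler_sum => i _.
  by rewrite -(csq_conj (y i)) ReM_abs.
by rewrite -(csq_conj (y i)) ImM_abs.
Qed.

Definition l2_dot x y : R[i] := csum (fun i => x i * Num.conj (y i)).

Lemma l2_dot_conj x y : l2_dot y x = Num.conj (l2_dot x y).
Proof.
rewrite /l2_dot -csum_conj; last exact: csummable_dot.
by congr csum; apply/funext => i; rewrite rmorphM /= conjCK mulrC.
Qed.

Lemma l2_dotPl a x y z : l2_dot (a *: x + y) z = a * l2_dot x z + l2_dot y z.
Proof.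
rewrite /l2_dot -csumP; [|exact: csummable_dot..].
by congr csum; apply/funext => i; rewrite l2E mulrDl mulrA.
Qed.

Lemma l2_dotPr a x y z :
  l2_dot z (a *: x + y) = Num.conj a * l2_dot z x + l2_dot z y.
Proof. by rewrite l2_dot_conj l2_dotPl rmorphD rmorphM /= -!l2_dot_conj. Qed.

Lemma l2_dot_bilinear :
  bilinear_for ( *%R : R[i] -> R[i] -> R[i]) (Num.conj \; *%R) l2_dot.
Proof. by split=> z a x y /=; [apply: l2_dotPl|apply: l2_dotPr]. Qed.

HB.instance Definition _ := bilinear_isBilinear.Build R[i] l2 l2 R[i]
  ( *%R : R[i] -> R[i] -> R[i]) (Num.conj \; *%R) l2_dot l2_dot_bilinear.

Fact l2_dot_herm x y : l2_dot x y = (-1) ^+ false * Num.conj (l2_dot y x).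
Proof. by rewrite expr0 mul1r -l2_dot_conj. Qed.

HB.instance Definition _ := isHermitianSesquilinear.Build R[i] l2 false Num.conj
  l2_dot l2_dot_herm.

Lemma l2_dotE x : l2_dot x x = (rsum (fun i => csq (x i)))%:C%C.
Proof.
rewrite /l2_dot /csum; congr Complex.
  by congr rsum; apply/funext => i; rewrite mulCconj.
by rewrite (@rsum_single _ 0) ?mulCconj // => i _; rewrite mulCconj.
Qed.

Fact l2_dot_gt0 x : x != 0 -> 0 < l2_dot x x.
Proof.
move=> x0; rewrite l2_dotE ltcR.
have [k xk] : exists k, x k != 0.
  apply: contra_notP (negP x0) => /forallNP xk; apply/eqP/l2P => i.
  by apply/eqP; rewrite l20E; apply: contra_notT (xk i).
apply: (@lt_le_trans _ _ (csq (x k))).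
  by rewrite lt_def csq_ge0 andbT csq_eq0.
apply: (@le_trans _ _ (sqsum x k.+1)).
  by rewrite /sqsum big_ord_recr /= lerDr sumr_ge0 // => i _; apply: csq_ge0.
by apply: rsum_ge_part => [|i]; [apply: sqsum_summable|apply: csq_ge0].
Qed.

HB.instance Definition _ := isDotProduct.Build R[i] l2 l2_dot l2_dot_gt0.

End SquareSummable.

(** * Cauchy-Schwarz and triangle inequality for a dot product *)

Section DotNorm.
Variables (C : numClosedFieldType) (U : lmodType C) (form : {dot U for Num.conj}).
Local Notation "''[' u , v ]" := (form u%R v%R) : ring_scope.
Local Notation "''[' u ]" := '[u, u]%R : ring_scope.

Lemma dot_CauchySchwarz u v : `|'[u, v]| ^+ 2 <= '[u] * '[v].
Proof.
have [->|v0] := eqVneq v 0; first by rewrite linear0r normr0 expr0n mulr_ge0 ?dnorm_ge0.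
have v_gt0 : 0 < '[v] by rewrite dnorm_gt0.
(* [a *: v] is the orthogonal projection of u on the line of v; nonnegativity of the squared
   distance to it is the claim. *)
pose a := '[u, v] / '[v].
have := dnorm_ge0 form (u - a *: v).
have conjv : Num.conj '[v] = '[v] by rewrite geC0_conj // ltW.
have dE : '[u, a *: v] = `|'[u, v]| ^+ 2 / '[v].
  rewrite linearZr_LR /= /a rmorphM fmorphV /= conjv normCK mulrAC.
  by rewrite [_ * '[u, v]]mulrC.
have d_real : Num.conj (`|'[u, v]| ^+ 2 / '[v]) = `|'[u, v]| ^+ 2 / '[v].
  by rewrite geC0_conj // divr_ge0 ?exprn_ge0 // ltW.
rewrite dnormB dE /= d_real dnormZ normrM normfV (gtr0_norm v_gt0) exprMn.
rewrite [_ * _ * '[v]](_ : _ = `|'[u, v]| ^+ 2 / '[v]); last first.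
  by rewrite expr2 -!mulrA mulVf ?gt_eqF // mulr1.
by rewrite opprD addrA addrK subr_ge0 ler_pdivrMr.
Qed.

Lemma dot_triangle u v : sqrtC '[u + v] <= sqrtC '[u] + sqrtC '[v].
Proof.
rewrite -ler_sqr ?nnegrE ?addr_ge0 ?sqrtC_ge0 ?dnorm_ge0 //.
rewrite sqrrD !sqrtCK addrAC dnormD lerD2l.
have -> : '[u, v] + Num.conj '[u, v] = 'Re '[u, v] *+ 2.
  by rewrite ReE -mulr_natr divfK ?pnatr_eq0.
rewrite lerMn2r /= -(sqrtCM (dnorm_ge0 _ _) (dnorm_ge0 _ _)).
apply: (@le_trans _ _ `|'[u, v]|).
  by have [] := leif_Re_Creal '[u, v].
rewrite -ler_sqr ?nnegrE ?sqrtC_ge0 ?mulr_ge0 ?dnorm_ge0 //.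
by rewrite sqrtCK dot_CauchySchwarz.
Qed.

End DotNorm.

Section HilbertL2.
Variables (R : realType) (D : set nat).
Local Notation H := (l2 R D).
Implicit Types x y z : H.

Definition l2_norm x : R[i] := sqrtC (l2_dot x x).

Fact l2_normD x y : l2_norm (x + y) <= l2_norm x + l2_norm y.
Proof. exact: (dot_triangle (l2_dot (R := R) (D := D))). Qed.

Fact l2_normZ (c : R[i]) x : l2_norm (c *: x) = `|c| * l2_norm x.
Proof.
rewrite /l2_norm (dnormZ (l2_dot (R := R) (D := D))).
by rewrite sqrtCM ?nnegrE ?exprn_ge0 ?(dnorm_ge0 (l2_dot (R := R) (D := D))) // sqrCK.
Qed.

Fact l2_norm0_eq0 x : l2_norm x = 0 -> x = 0.
Proof.
move=> /eqP; rewrite /l2_norm (sqrt_dnorm_eq0 (l2_dot (R := R) (D := D))).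
by move/eqP.
Qed.

HB.instance Definition _ :=
  Lmodule_isNormed.Build R[i] H l2_normD l2_normZ l2_norm0_eq0.

Lemma l2_normE x : `|x| ^+ 2 = (rsum (fun i => csq (x i)))%:C%C.
Proof. by rewrite -l2_dotE -[RHS]sqrtCK. Qed.

End HilbertL2.
Section RealNorm.
Variables (R : realType) (V : normedModType R[i]).
Implicit Types v w : V.

Lemma rnormE v : (rnorm v)%:C%C = `|v|.
Proof. by rewrite /rnorm RRe_ge0. Qed.

Lemma rnorm_ge0 v : 0 <= rnorm v.
Proof. by rewrite -ler0c rnormE. Qed.

Lemma rnormD v w : rnorm (v + w) <= rnorm v + rnorm w.
Proof. by rewrite -lecR rmorphD /= !rnormE ler_normD. Qed.

Lemma rnormN v : rnorm (- v) = rnorm v.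
Proof. by rewrite /rnorm normrN. Qed.

Lemma rnormB v w : rnorm (v - w) = rnorm (w - v).
Proof. by rewrite /rnorm distrC. Qed.

Lemma rnorm0 : rnorm (0 : V) = 0.
Proof. by rewrite /rnorm normr0. Qed.

Lemma rnorm_eq0 v : rnorm v = 0 -> v = 0.
Proof. by move=> v0; apply/normr0_eq0; rewrite -rnormE v0. Qed.

Lemma rnormZ (c : R[i]) v : rnorm (c *: v) = Num.sqrt (csq c) * rnorm v.
Proof.
apply: complexI; rewrite rmorphM /= !rnormE normrZ; congr (_ * _).
by rewrite normc_def.
Qed.

Lemma rnorm_sum (I : Type) (r : seq I) (P : pred I) (F : I -> V) :
  rnorm (\sum_(i <- r | P i) F i) <= \sum_(i <- r | P i) rnorm (F i).
Proof.
elim/big_rec2: _ => [|i y v _ IH]; first by rewrite rnorm0.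
by apply: le_trans (rnormD _ _) _; rewrite lerD2l.
Qed.

Lemma rnorm_ball v (e : R) : 0 < e -> ball v e%:C%C = [set w | rnorm (v - w) < e].
Proof.
move=> e0; apply/seteqP; split=> w; rewrite -ball_normE /ball_ /=.
  by rewrite -rnormE ltcR.
by rewrite -(ltcR (rnorm _)) rnormE.
Qed.

Lemma closure_rnormP (B : set V) v :
  closure B v <-> forall e, 0 < e -> exists2 w, B w & rnorm (v - w) < e.
Proof.
split=> [cB e e0|h U].
  have [|w [Bw vw]] := cB (ball v e%:C%C); first by apply: nbhsx_ballx; rewrite ltcR.
  by exists w => //; rewrite rnorm_ball in vw.
move=> /nbhs_ballP[e /= e0 eU].
have eE : (complex.Re e)%:C%C = e by rewrite RRe_ge0 // ltW.
have r0 : 0 < complex.Re e by rewrite -ltcR eE.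
have [w Bw vw] := h _ r0; exists w; split=> //; apply: eU.
by rewrite -eE rnorm_ball.
Qed.

Lemma closed_rnormP (B : set V) : closed B <->
  forall v, (forall e, 0 < e -> exists2 w, B w & rnorm (v - w) < e) -> B v.
Proof.
rewrite closure_id; split=> [BE v /closure_rnormP|h].
  by rewrite -BE.
by apply/seteqP; split=> [|v /closure_rnormP]; [exact: subset_closure|exact: h].
Qed.

End RealNorm.

Section HilbertL2Complete.
Variables (R : realType) (D : set nat).
Local Notation H := (l2 R D).
Implicit Types x y z : H.

Lemma l2_rnormE x : rnorm x ^+ 2 = rsum (fun i => csq (x i)).
Proof. by apply: complexI; rewrite rmorphXn /= rnormE l2_normE. Qed.

Lemma sqsum_le_rnorm x N : sqsum x N <= rnorm x ^+ 2.
Proof.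
rewrite l2_rnormE; apply: rsum_ge_part => [|i]; first exact: sqsum_summable.
exact: csq_ge0.
Qed.

Lemma rnorm_le_sqsum x c : 0 <= c -> (forall N, sqsum x N <= c ^+ 2) ->
  rnorm x <= c.
Proof.
move=> c0 xc; rewrite -ler_sqr ?nnegrE ?rnorm_ge0 // l2_rnormE.
by apply: rsum_le => //; apply: sqsum_summable.
Qed.

Lemma csq_le_rnorm x i : csq (x i) <= rnorm x ^+ 2.
Proof.
apply: le_trans (sqsum_le_rnorm x i.+1).
by rewrite /sqsum big_ord_recr /= lerDr sumr_ge0 // => j _; apply: csq_ge0.
Qed.

Lemma Re_le_rnorm x i : `|complex.Re (x i)| <= rnorm x.
Proof.
rewrite -ler_sqr ?nnegrE ?rnorm_ge0 // real_normK ?num_real //.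
by apply: le_trans (csq_le_rnorm x i); rewrite lerDl sqr_ge0.
Qed.

Lemma Im_le_rnorm x i : `|complex.Im (x i)| <= rnorm x.
Proof.
rewrite -ler_sqr ?nnegrE ?rnorm_ge0 // real_normK ?num_real //.
by apply: le_trans (csq_le_rnorm x i); rewrite lerDr sqr_ge0.
Qed.

Lemma sqsumD_le (f g : nat -> R[i]) N :
  sqsum (fun i => f i + g i) N <= 2 * sqsum f N + 2 * sqsum g N.
Proof.
by rewrite /sqsum !mulr_sumr -big_split /=; apply: ler_sum => i _; apply: csqD.
Qed.

Section CauchyFilter.
Variables (F : set_system H) (FF : ProperFilter F) (Fc : cauchy F).

Let Fball (e : R) : 0 < e -> exists x, F [set y | rnorm (x - y) < e].
Proof.
move=> e0; have /cauchyP/(_ (e%:C)%C) [|x] := Fc; first by rewrite ltcR.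
by rewrite rnorm_ball // => Fx; exists x.
Qed.

Let coord_cvg (p : H -> R) : (forall x y, `|p x - p y| <= rnorm (x - y)) ->
  cvg (p @ F).
Proof.
move=> pL; apply: R_complete; apply/cauchyP => e e0.
have [x Fx] := Fball e0; exists (p x); change (F (p @^-1` ball (p x) e)).
by apply: filterS Fx => y /= xy; apply: le_lt_trans xy; apply: pL.
Qed.

Let Re_cvg i : cvg ((fun x : H => complex.Re (x i)) @ F).
Proof.
apply: coord_cvg => x y; apply: le_trans (Re_le_rnorm _ i).
by rewrite l2DE l2NE; case: (x i) => ? ?; case: (y i).
Qed.

Let Im_cvg i : cvg ((fun x : H => complex.Im (x i)) @ F).
Proof.
apply: coord_cvg => x y; apply: le_trans (Im_le_rnorm _ i).
by rewrite l2DE l2NE; case: (x i) => ? ?; case: (y i).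
Qed.

Let G (i : nat) : R[i] :=
  (lim ((fun x : H => complex.Re (x i)) @ F) +i*
   lim ((fun x : H => complex.Im (x i)) @ F))%C.

(** A prefix sum depends continuously on finitely many coordinates, so the bound valid for F-many y
    passes to the coordinatewise limit [G], with strictness lost. *)
Let sqsum_lim x e N : F [set y | rnorm (x - y) < e] ->
  sqsum (fun i => x i - G i) N <= e ^+ 2.
Proof.
move=> Fx.
have cv : (fun y : H => sqsum (x - y : H) N) @ F -->
    sqsum (fun i => x i - G i) N.
  elim: N => [|i IH].
    rewrite /sqsum big_ord0; under eq_fun do rewrite big_ord0.
    exact: cvg_cst.
  rewrite /sqsum big_ord_recr /=; under eq_fun do rewrite big_ord_recr /=.
  apply: cvgD IH _.
  have -> : (fun y : H => csq ((x - y) i)) = (fun y : H =>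
      (complex.Re (x i) - complex.Re (y i)) * (complex.Re (x i) - complex.Re (y i)) +
      (complex.Im (x i) - complex.Im (y i)) * (complex.Im (x i) - complex.Im (y i))).
    apply/funext => y; rewrite l2DE l2NE.
    by case: (x i) (y i) => a b [c d]; rewrite /csq /= !expr2.
  have -> : csq (x i - G i) =
      (complex.Re (x i) - complex.Re (G i)) * (complex.Re (x i) - complex.Re (G i)) +
      (complex.Im (x i) - complex.Im (G i)) * (complex.Im (x i) - complex.Im (G i)).
    by case: (x i) => a b; rewrite /csq /= !expr2.
  apply: cvgD; apply: cvgM; apply: cvgB.
  - exact: cvg_cst.
  - exact: Re_cvg.
  - exact: cvg_cst.
  - exact: Re_cvg.
  - exact: cvg_cst.
  - exact: Im_cvg.
  - exact: cvg_cst.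
  - exact: Im_cvg.
apply: (cvgr_to_le cv); apply: filterS Fx => y /= xy.
apply: le_trans (sqsum_le_rnorm (x - y) N) _.
by rewrite ler_sqr ?nnegrE ?rnorm_ge0 ?ltW // (le_lt_trans (rnorm_ge0 _) xy).
Qed.

Let G_l2 : G \in @l2_pred R D.
Proof.
apply/l2_predP; split=> [i Di|].
  have E (p : R[i] -> R) : p 0 = 0 -> lim ((fun x : H => p (x i)) @ F) = 0.
    move=> p0; have -> : (fun x : H => p (x i)) = fun=> 0.
      by apply/funext => x; rewrite l2_supp.
    exact: lim_cst.
  by rewrite /G !E.
have [x Fx] := Fball ltr01; have [K xK] := l2_bounded x.
(* Write G = x - (x - G) with x within distance 1 of F-many vectors; the factors 2 are those of
   [csqD]. *)
exists (2 * K + 2 * 1) => N.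
have -> : sqsum G N = sqsum (fun i => x i + (- (x i - G i))) N.
  by apply: eq_bigr => i _; rewrite opprB addrC subrK.
apply: le_trans (sqsumD_le _ _ _) _; rewrite lerD ?ler_wpM2l //.
rewrite -(expr1n _ 2); apply: le_trans (sqsum_lim N Fx).
by apply: ler_sum => i _; rewrite csqN.
Qed.

Lemma l2_cauchy_cvg : cvg F.
Proof.
pose g := L2 G_l2; apply/cvg_ex; exists g; apply/cvg_ballP => e e0.
have eE : (complex.Re e)%:C%C = e by rewrite RRe_ge0 // ltW.
have r0 : 0 < complex.Re e by rewrite -ltcR eE.
rewrite -eE; set r := complex.Re e in r0 *.
have r30 : 0 < r / 3 by rewrite divr_gt0.
have [x Fx] := Fball r30.
have gx : rnorm (g - x) <= r / 3.
  rewrite rnormB; apply: rnorm_le_sqsum => [|N]; first exact: ltW.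
  exact: sqsum_lim.
apply: filterS Fx => y /= xy; rewrite rnorm_ball //=.
have -> : g - y = (g - x) + (x - y) by rewrite addrA subrK.
by apply: le_lt_trans (rnormD _ _) _; lra.
Qed.

End CauchyFilter.

HB.instance Definition _ := Uniform_isComplete.Build H l2_cauchy_cvg.

Fact l2_dot_norm x : l2_dot x x = `|x| ^+ 2.
Proof. by rewrite l2_dotE l2_normE. Qed.

HB.instance Definition _ := isHilbert.Build R H l2_dot_norm.

Lemma l2_hdotE x y : hdot x y = csum (fun i => x i * Num.conj (y i)).
Proof. by []. Qed.

End HilbertL2Complete.

(** * The norm of a finite dimensional C*-algebra *)

Section VectorNorm.
Variable R : realType.
Local Notation C := R[i].

Definition csqv m (v : 'cV[C]_m) : R := \sum_i csq (v i 0).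
Definition adjmx m p (M : 'M[C]_(m, p)) : 'M[C]_(p, m) := map_mx Num.conj M^T.

Lemma csqv_ge0 m (v : 'cV[C]_m) : 0 <= csqv v.
Proof. by apply: sumr_ge0 => i _; apply: csq_ge0. Qed.

Lemma adjmxK m p : cancel (@adjmx m p) (@adjmx p m).
Proof. by move=> M; apply/matrixP => i j; rewrite !mxE conjCK. Qed.

Lemma csqvE m (v : 'cV[C]_m) : (csqv v)%:C%C = (adjmx v *m v) 0 0.
Proof.
rewrite mxE /csqv rmorph_sum /=; apply: eq_bigr => i _.
by rewrite !mxE mulrC mulCconj.
Qed.

Lemma csqv_CauchySchwarz m (u v : 'cV[C]_m) :
  csq ((adjmx v *m u) 0 0) <= csqv u * csqv v.
Proof.
rewrite -lecR csqE rmorphM /= !csqvE.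
have dE (a b : 'cV[C]_m) : dotmx a^T b^T = (adjmx b *m a) 0 0.
  rewrite dotmxE !mxE; apply: eq_bigr => i _; rewrite !mxE mulrC.
  by [].
rewrite -!dE; exact: (dot_CauchySchwarz (@dotmx C m) u^T v^T).
Qed.

Lemma adjmxM m p q (M : 'M[C]_(m, p)) (N : 'M[C]_(p, q)) :
  adjmx (M *m N) = adjmx N *m adjmx M.
Proof. by rewrite /adjmx trmx_mul map_mxM. Qed.

(** Cauchy-Schwarz applied to ||Mv||^2 = <M* M v, v>: the counterpart on vectors of the
    C*-identity. *)
Lemma csqv_sqr_le m p (M : 'M[C]_(p, m)) v :
  csqv (M *m v) ^+ 2 <= csqv (adjmx M *m M *m v) * csqv v.
Proof.
have := csqv_CauchySchwarz (adjmx M *m M *m v) v.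
by rewrite -!mulmxA mulmxA -adjmxM -csqvE /csq /= expr0n addr0.
Qed.

(** With w = M* v, [csqv_sqr_le] for M* gives ||w||^4 <= ||M w||^2 ||v||^2 <= c ||w||^2 ||v||^2;
    then divide by ||w||^2. *)
Lemma csqv_adj_le m p (M : 'M[C]_(p, m)) (c : R) : 0 <= c ->
  (forall v, csqv (M *m v) <= c * csqv v) ->
  forall v, csqv (adjmx M *m v) <= c * csqv v.
Proof.
move=> c0 Mc v; have := csqv_sqr_le (adjmx M) v.
rewrite adjmxK -mulmxA; set w := adjmx M *m v => ww.
have /(ler_wpM2r (csqv_ge0 v)) Mw := Mc w.
have := csqv_ge0 w; rewrite le_eqVlt => /predU1P[<-|w0].
  by rewrite mulr_ge0 ?csqv_ge0.
have := le_trans ww Mw; rewrite expr2 mulrAC ler_pM2r //.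
Qed.

(** Cauchy-Schwarz on each row. The dimensional factor may be crude, since [le_of_pow2] removes
    it. *)
Lemma csqv_mulmx_le m p (M : 'M[C]_(p, m)) (c : R) v :
  (forall i j, csq (M i j) <= c) -> csqv (M *m v) <= c *+ (p * m) * csqv v.
Proof.
move=> Mc.
have row_le i : csq ((M *m v) i 0) <= c *+ m * csqv v.
  have := csqv_CauchySchwarz v (adjmx (row i M)); rewrite adjmxK mulrC.
  have -> : (row i M *m v) 0 0 = (M *m v) i 0 by rewrite -row_mul mxE.
  move=> /le_trans; apply; rewrite ler_wpM2r ?csqv_ge0 //.
  apply: (@le_trans _ _ (\sum_(j < m) c)).
    by apply: ler_sum => j _; rewrite !mxE csq_conj.
  by rewrite sumr_const card_ord.
apply: (@le_trans _ _ (\sum_(i < p) c *+ m * csqv v)).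
  by apply: ler_sum => i _.
by rewrite sumr_const card_ord -mulrnAl -mulrnA mulnC.
Qed.

End VectorNorm.

Section Entries.
Variables (R : realType) (k : nat) (n : 'I_k.+1 -> nat).
Local Notation C := R[i].
Local Notation F := (fdalg R n).
Implicit Types (x y : F) (u v : munit_idx n).

Definition muidx (j : 'I_k.+1) (p q : 'I_(n j).+1) : munit_idx n :=
  Tagged (fun j => ('I_(n j).+1 * 'I_(n j).+1)%type) (p, q).

Definition entry x u : C := x (tag u) (tagged u).1 (tagged u).2.

Lemma muidx_ind (P : munit_idx n -> Prop) :
  (forall j p q, P (@muidx j p q)) -> forall u, P u.
Proof. by move=> h [j [p q]]; apply: h. Qed.

Lemma entryE x j p q : entry x (muidx p q) = x j p q.
Proof. by []. Qed.

Lemma entryP x y : (forall u, entry x u = entry y u) -> x = y.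
Proof.
move=> xy; apply/ffunP => j; apply/matrixP => p q.
by rewrite -!entryE xy.
Qed.

Lemma entryD x y u : entry (x + y) u = entry x u + entry y u.
Proof. by rewrite /entry !ffunE !mxE. Qed.
Lemma entryZ c x u : entry (c *: x) u = c * entry x u.
Proof. by rewrite /entry !ffunE !mxE. Qed.
Lemma entry0 u : entry 0 u = 0.
Proof. by rewrite /entry !ffunE !mxE. Qed.
Lemma entry_sum I (r : seq I) P (G : I -> F) u :
  entry (\sum_(i <- r | P i) G i) u = \sum_(i <- r | P i) entry (G i) u.
Proof. exact: (big_morph (entry^~ u) (fun x y => entryD x y u) (entry0 u)). Qed.

Lemma entryM x y j (p q : 'I_(n j).+1) :
  entry (amul x y) (muidx p q) = \sum_r entry x (muidx p r) * entry y (muidx r q).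
Proof. by rewrite /entry !ffunE !mxE. Qed.

Lemma entry_star x j (p q : 'I_(n j).+1) :
  entry (astar x) (muidx p q) = Num.conj (entry x (muidx q p)).
Proof. by rewrite /entry !ffunE !mxE. Qed.

Lemma entry_munit u v : entry (munit R u) v = (v == u)%:R.
Proof. by case: v => j [p q]; rewrite /entry !ffunE mxE. Qed.

Lemma muidx_eq j (p q r s : 'I_(n j).+1) :
  (muidx p q == muidx r s) = (p == r) && (q == s).
Proof. by rewrite /muidx -tag_eqE /tag_eq /= eqxx tagged_asE xpair_eqE. Qed.

Lemma fd_decomp x : x = \sum_u entry x u *: munit R u.
Proof.
apply: entryP => v; rewrite entry_sum.
rewrite (eq_bigr (fun u => entry x u * (v == u)%:R)) => [|u _]; last first.
  by rewrite (entryZ (entry x u) (munit R u)) entry_munit.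
rewrite (bigD1 v) //= eqxx mulr1 big1 ?addr0 // => u uv.
by rewrite eq_sym (negPf uv) mulr0.
Qed.

Lemma munit_mul_munit x j (p q : 'I_(n j).+1) :
  amul (amul (munit R (muidx p p)) x) (munit R (muidx q q)) =
  entry x (muidx p q) *: munit R (muidx p q).
Proof.
apply: entryP; elim/muidx_ind => j' r s.
rewrite entryM [RHS](entryZ _ (munit R _)) [in RHS]entry_munit.
have [jj|jj] := eqVneq j' j; last first.
  rewrite big1 => [|t _]; last first.
    rewrite !entry_munit -!tag_eqE /tag_eq /= (negPf jj) /= mulr0 //.
  by rewrite -tag_eqE /tag_eq /= (negPf jj) /= mulr0.
subst j'; rewrite (bigD1 q) //= big1 ?addr0 => [|t tq]; last first.
  by rewrite entry_munit muidx_eq (negPf tq) /= mulr0.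
rewrite entry_munit !muidx_eq eqxx /= entryM (bigD1 p) //= big1 ?addr0 => [|t tp].
  rewrite entry_munit muidx_eq eqxx andbT.
  by have [_|_] := eqVneq r p; have [_|_] := eqVneq s q; rewrite ?mul1r ?mul0r ?mulr0.
by rewrite entry_munit muidx_eq (negPf tp) andbF mul0r.
Qed.

End Entries.

(** * Isometry of injective star-homomorphisms, by iterating the C*-identity *)

Section CStarNorm.
Variables (R : realType) (k : nat) (n : 'I_k.+1 -> nat).
Variables (A : cstarAlgType R) (psi : {linear fdalg R n -> A}).
Hypotheses (psi_hom : star_hom psi) (psi_inj : injective psi).
Local Notation C := R[i].
Local Notation F := (fdalg R n).
Implicit Types (x y : F) (u v : munit_idx n).

Lemma rnorm_amul (a b : A) : rnorm (amul a b) <= rnorm a * rnorm b.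
Proof. by rewrite -lecR rmorphM /= !rnormE cstar_normM. Qed.

Lemma rnorm_cstar (a : A) : rnorm (amul (astar a) a) = rnorm a ^+ 2.
Proof. by apply: complexI; rewrite rmorphXn /= !rnormE cstar_norm. Qed.

Lemma munit_neq0 u : munit R u != 0.
Proof.
apply/eqP => u0; have := entry_munit R u u; rewrite u0 entry0 eqxx.
by move/eqP; rewrite eq_sym oner_eq0.
Qed.

(** Since e_pp x e_qq = x_pq e_pq, the modulus of x_pq is at most ||e_pp|| ||x|| ||e_qq|| /
    ||e_pq||, where ||e_pq|| > 0 by injectivity of [psi]. Summing the squared quotients over all
    units gives one constant. *)
Lemma entry_le_rnorm : exists2 K : R, 0 <= K &
  forall x u, csq (entry x u) <= K * rnorm (psi x) ^+ 2.
Proof.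
pose N j (p q : 'I_(n j).+1) := rnorm (psi (munit R (muidx p q))).
have N_gt0 j (p q : 'I_(n j).+1) : 0 < N j p q.
  rewrite lt_def rnorm_ge0 andbT; apply/eqP => /rnorm_eq0 e0.
  have /eqP := munit_neq0 (muidx p q); apply.
  by apply: psi_inj; rewrite e0 linear0.
pose K1 u := (N (tag u) (tagged u).1 (tagged u).1 *
  N (tag u) (tagged u).2 (tagged u).2 / N (tag u) (tagged u).1 (tagged u).2) ^+ 2.
have K1_ge0 u : 0 <= K1 u by apply: sqr_ge0.
exists (\sum_u K1 u); first exact: sumr_ge0.
move=> x u; apply: (@le_trans _ _ (K1 u * rnorm (psi x) ^+ 2)); last first.
  by rewrite ler_wpM2r ?sqr_ge0 // (bigD1 u) //= lerDl sumr_ge0.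
elim/muidx_ind: u => j p q; rewrite /K1 /= -exprMn.
have := congr1 (fun y => rnorm (psi y)) (munit_mul_munit x p q).
rewrite (linearZ_LR psi) rnormZ /= => eN.
have : rnorm (psi (amul (amul (munit R (muidx p p)) x) (munit R (muidx q q)))) <=
    N j p p * rnorm (psi x) * N j q q.
  rewrite !psi_hom.1; apply: le_trans (rnorm_amul _ _) _.
  by rewrite ler_wpM2r ?rnorm_ge0 // rnorm_amul.
rewrite eN -/(N j p q) -ler_pdivlMr // => le.
rewrite -(sqr_sqrtr (csq_ge0 (entry x (muidx p q)))) ler_sqr ?nnegrE ?sqrtr_ge0 //.
  by move: le; rewrite (mulrAC (N j p p)) (mulrAC _ (rnorm (psi x))).
by rewrite !mulr_ge0 ?rnorm_ge0 ?invr_ge0 // ltW.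
Qed.

Lemma rnorm_le_entry : exists2 K : R, 0 <= K & forall x (c : R), 0 <= c ->
  (forall u, csq (entry x u) <= c ^+ 2) -> rnorm (psi x) <= K * c.
Proof.
exists (\sum_u rnorm (psi (munit R u))).
  by apply: sumr_ge0 => u _; apply: rnorm_ge0.
move=> x c c0 xc; rewrite {1}(fd_decomp x) (linear_sum psi).
apply: le_trans (rnorm_sum _ _ _) _; rewrite mulr_suml; apply: ler_sum => u _.
rewrite (linearZ_LR psi) rnormZ mulrC ler_wpM2l ?rnorm_ge0 //.
by rewrite -[leRHS](ger0_norm c0) -sqrtr_sqr ler_sqrt ?sqr_ge0.
Qed.

(** Iterates of x -> x* x. Their norms are exact powers ||x||^(2^i), so an estimate with a constant
    independent of i becomes sharp after extracting roots. *)
Fixpoint csiter x i : F :=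
  if i is i'.+1 then amul (astar (csiter x i')) (csiter x i') else x.

Lemma rnorm_csiter x i : rnorm (psi (csiter x i)) = rnorm (psi x) ^+ (2 ^ i).
Proof.
elim: i => //= i IH.
by rewrite psi_hom.1 psi_hom.2 rnorm_cstar IH -exprM expnS mulnC.
Qed.

Lemma csiterS x i j :
  csiter x i.+1 j = adjmx (csiter x i j) *m csiter x i j.
Proof. by rewrite /= !ffunE. Qed.

(** Iterated [csqv_sqr_le]. Squaring doubles the exponent 2^i - 1 of the last factor and the new
    step adds one, which gives 2^(i+1) - 1. *)
Lemma csqv_csiter x i j (v : 'cV[C]_(n j).+1) :
  csqv (x j *m v) ^+ (2 ^ i) <= csqv (csiter x i j *m v) * csqv v ^+ (2 ^ i).-1.
Proof.
elim: i => [|i IH]; first by rewrite expr0 mulr1.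
rewrite csiterS expnS mulnC exprM.
apply: (@le_trans _ _ ((csqv (csiter x i j *m v) * csqv v ^+ (2 ^ i).-1) ^+ 2)).
  by rewrite ler_sqr ?nnegrE ?mulr_ge0 ?exprn_ge0 ?csqv_ge0.
rewrite exprMn; apply: le_trans (ler_wpM2r _ (csqv_sqr_le _ _)) _.
  by rewrite exprn_ge0 ?exprn_ge0 ?csqv_ge0.
rewrite -mulrA -exprM -exprS le_eqVlt; apply/orP; left; apply/eqP.
congr (_ * _ ^+ _); have : (0 < 2 ^ i)%N by rewrite expn_gt0.
lia.
Qed.

(** If t > s > 0, Bernoulli's inequality makes (t / s)^(2^i) exceed K for large i; if s = 0, the
    case i = 0 already suffices. *)
Lemma le_of_pow2 (K s t : R) : 0 <= s -> 0 <= t ->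
  (forall i, t ^+ (2 ^ i) <= K * s ^+ (2 ^ i)) -> t <= s.
Proof.
move=> s0 t0 h; rewrite leNgt; apply/negP => st.
have tp : 0 < t by apply: le_lt_trans st.
move: s0; rewrite le_eqVlt => /predU1P[s0|s0].
  by have := h 0%N; rewrite -s0 !expn0 !expr1 mulr0 leNgt tp.
pose d := t / s - 1; have d0 : 0 < d by rewrite subr_gt0 ltr_pdivlMr ?mul1r.
have ts : t / s = 1 + d by rewrite /d addrC subrK.
have hd i : 1 + d *+ i <= K.
  have Kt : (t / s) ^+ (2 ^ i) <= K.
    by rewrite expr_div_n ler_pdivrMr ?exprn_gt0.
  apply: le_trans Kt; rewrite ts.
  apply: (@le_trans _ _ (1 + d *+ (2 ^ i))).
    by rewrite lerD2l -!(mulr_natr d) ler_pM2l // ler_nat ltnW // ltn_expl.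
  elim: (2 ^ i)%N => [|m IH]; first by rewrite expr0 addr0.
  rewrite exprS; apply: le_trans (ler_wpM2l _ IH); last by rewrite addr_ge0 // ltW.
  have dm : 0 <= d *+ m by rewrite mulrn_wge0 // ltW.
  by rewrite mulrS; have := mulr_ge0 (ltW d0) dm; lra.
have K0 : 0 <= K by apply: le_trans (hd 0%N); rewrite addr0.
have := hd (Num.bound (K / d)); apply/negP; rewrite -ltNge.
apply: (@lt_trans _ _ (d *+ Num.bound (K / d))); last by rewrite ltrDr.
rewrite -mulr_natl -ltr_pdivrMr //; apply: le_lt_trans (archi_boundP _).
  by [].
by rewrite divr_ge0 // ltW.
Qed.

(** The entry bound controls the iterate [csiter x i] up to a factor independent of i, and
    [csqv_csiter] turns this into the 2^i-th power of the desired inequality. *)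
Lemma csqv_le_rnorm x j (v : 'cV[C]_(n j).+1) :
  csqv (x j *m v) <= rnorm (psi x) ^+ 2 * csqv v.
Proof.
have [K K0 hK] := entry_le_rnorm.
have r0 := rnorm_ge0 (psi x).
apply: (@le_of_pow2 (K *+ ((n j).+1 * (n j).+1))); rewrite ?mulr_ge0 ?csqv_ge0 ?sqr_ge0 //.
move=> i; apply: le_trans (csqv_csiter _ _ _) _.
have hM : csqv (csiter x i j *m v) <=
    (K * rnorm (psi (csiter x i)) ^+ 2) *+ ((n j).+1 * (n j).+1) * csqv v.
  by apply: csqv_mulmx_le => p q; exact: hK _ (muidx p q).
apply: le_trans (ler_wpM2r _ hM) _; first by rewrite exprn_ge0 ?csqv_ge0.
rewrite rnorm_csiter -mulrA -exprS prednK ?expn_gt0 // exprMn -!exprM.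
by rewrite [(2 * 2 ^ i)%N]mulnC !mulrnAl mulrA.
Qed.

(** The operator bound c passes to the iterates, because a matrix and its adjoint share their bounds
    and hence x* x has bound c^2. Basis vectors then bound the entries, and these the norm up to a
    constant. *)
Lemma rnorm_le_csqv x (c : R) : 0 <= c ->
  (forall j (v : 'cV[C]_(n j).+1), csqv (x j *m v) <= c ^+ 2 * csqv v) ->
  rnorm (psi x) <= c.
Proof.
move=> c0 xc; have [K K0 hK] := rnorm_le_entry.
have xic i j (v : 'cV[C]_(n j).+1) :
    csqv (csiter x i j *m v) <= (c ^+ (2 ^ i)) ^+ 2 * csqv v.
  elim: i v => [|i IH] v; first by rewrite expr1.
  rewrite csiterS -mulmxA.
  apply: le_trans (csqv_adj_le _ IH _) _; first by rewrite exprn_ge0 ?exprn_ge0.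
  apply: le_trans (ler_wpM2l _ (IH v)) _; first by rewrite exprn_ge0 ?exprn_ge0.
  rewrite mulrA -!exprM -exprD expnS le_eqVlt; apply/orP; left; apply/eqP.
  by congr (_ ^+ _ * _); lia.
apply: (@le_of_pow2 K) => //; first exact: rnorm_ge0.
move=> i; rewrite -rnorm_csiter; apply: hK => [|u]; first by rewrite exprn_ge0.
elim/muidx_ind: u => j p q; rewrite entryE.
have := xic i j (delta_mx q 0).
have -> : csqv (delta_mx q 0 : 'cV[C]_(n j).+1) = 1.
  rewrite /csqv (bigD1 q) //= mxE !eqxx csq1 big1 ?addr0 // => r rq.
  by rewrite mxE (negPf rq) csq0.
rewrite mulr1 -colE; apply: le_trans.
rewrite /csqv (bigD1 p) //= mxE lerDl sumr_ge0 // => r _; exact: csq_ge0.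
Qed.

End CStarNorm.

(** * Regular embeddings *)

Section Koenig.

(** If every x failed at some stage, the maximum of these stages would defeat all of the finite type
    at once, since [P] shrinks as i grows. *)
Lemma finite_uniform (T : finType) (P : nat -> T -> Prop) :
  (forall i x, P i.+1 x -> P i x) -> (forall i, exists x, P i x) ->
  exists x, forall i, P i x.
Proof.
move=> Pmono Pex; apply: contrapT => /forallNP noP.
have /choice[K hK] : forall x, exists i, ~ P i x by move=> x; apply/existsNP/noP.
have Ple i j x : (i <= j)%N -> P j x -> P i x.
  by elim: j => [|j IH]; rewrite leq_eqVlt => /predU1P[->|] // ij /Pmono; apply: IH.
have [x Px] := Pex (\max_x K x).
by apply: (hK x); apply: Ple Px; apply: leq_bigmax.
Qed.

Variables (T : nat -> finType) (S : forall i, T i -> Prop).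
Variable E : forall i, T i -> T i.+1 -> Prop.
Hypothesis S_ex : forall i, exists x, @S i x.
Hypothesis S_parent : forall i (y : T i.+1), S y -> exists2 x, S x & E x y.

Let Fixpoint anc d i (x : T i) : Prop :=
  S x /\ if d is d'.+1 then exists2 y, E x y & anc d' y else True.

Let anc_S d i (x : T i) : anc d x -> S x.
Proof. by case: d => [|d] []. Qed.

Let anc_mono d i (x : T i) : anc d.+1 x -> anc d x.
Proof.
elim: d i x => [|d IH] i x [Sx [y Exy yd]]; first by [].
by split=> //; exists y => //; apply: IH.
Qed.

(** Only parents are given, not children, so long paths are produced by climbing: take a suitable
    vertex one level further down and pass to its parent. *)
Let anc_ex d i : exists x : T i, anc d x.
Proof.
elim: d i => [|d IH] i; first by have [x] := S_ex i; exists x.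
have [y yd] := IH i.+1; have [x Sx Exy] := S_parent (anc_S yd).
by exists x; split=> //; exists y.
Qed.

Let good i (x : T i) := forall d, anc d x.

(** The edge is made part of the predicate, so that [finite_uniform] selects a single child that
    works for all depths. *)
Let good_child i (x : T i) : good x -> exists2 y, E x y & good y.
Proof.
move=> gx; have [d y [Exy /anc_mono]|d|y gy] :=
    @finite_uniform (T i.+1) (fun d y => E x y /\ anc d y).
- by [].
- by have [_ [y]] := gx d.+1; exists y.
- by exists y; [have [] := gy 0%N|move=> d; have [] := gy d].
Qed.

Lemma koenig : exists w : forall i, T i, forall i, S (w i) /\ E (w i) (w i.+1).
Proof.
have [x0 gx0] : exists x : T 0, good x.
  by apply: finite_uniform => [d x|d]; [exact: anc_mono|exact: anc_ex].
have next i (x : {x : T i | good x}) :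
    {y : {y : T i.+1 | good y} | E (sval x) (sval y)}.
  apply: cid; have [y Exy gy] := good_child (svalP x).
  by exists (exist _ y gy).
pose fix w i : {x : T i | good x} :=
  if i is i'.+1 then sval (next i' (w i')) else exist _ x0 gx0.
exists (fun i => sval (w i)) => i; split.
  exact: anc_S (svalP (w i) 0%N).
exact: svalP (next i (w i)).
Qed.

End Koenig.

(** * Combinatorics of matrix units under a regular embedding *)

Section MatrixUnits.
Variables (R : realType) (k : nat) (n : 'I_k.+1 -> nat).
Implicit Types (u v : munit_idx n).

(** The summand is kept as a tag, which allows comparison of row indices from different summands. *)
Definition lidx u : {j & 'I_(n j).+1} :=
  Tagged (fun j => 'I_(n j).+1) (tagged u).1.
Definition ridx u : {j & 'I_(n j).+1} :=
  Tagged (fun j => 'I_(n j).+1) (tagged u).2.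
Definition flip u : munit_idx n := muidx (tagged u).2 (tagged u).1.

Lemma lidx_eqP j (p q r s : 'I_(n j).+1) :
  lidx (muidx p q) = lidx (muidx r s) -> p = r.
Proof.
by move/eqP; rewrite -tag_eqE /tag_eq /= eqxx tagged_asE => /eqP.
Qed.

Lemma ridx_eqP j (p q r s : 'I_(n j).+1) :
  ridx (muidx p q) = ridx (muidx r s) -> q = s.
Proof.
by move/eqP; rewrite -tag_eqE /tag_eq /= eqxx tagged_asE => /eqP.
Qed.

Lemma munitM j (p q r : 'I_(n j).+1) :
  amul (munit R (muidx p q)) (munit R (muidx q r)) = munit R (muidx p r).
Proof.
apply: entryP; elim/muidx_ind => j' a b; rewrite entryM [RHS](entry_munit R (muidx p r)).
under eq_bigr => t _ do rewrite [X in X * _]entry_munit [X in _ * X]entry_munit.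
have [jj|jj] := eqVneq j' j; last first.
  rewrite -[in RHS]tag_eqE /tag_eq /= (negPf jj) big1 // => t _.
  by rewrite -tag_eqE /tag_eq /= (negPf jj) mul0r.
subst j'; rewrite (bigD1 q) //= big1 => [|t tq].
  by rewrite addr0 !muidx_eq eqxx andbT /= -natrM mulnb.
by rewrite !muidx_eq (negPf tq) andbF mul0r.
Qed.

Lemma munitM0 u v : ridx u <> lidx v -> amul (munit R u) (munit R v) = 0.
Proof.
move=> uv; apply: entryP; elim/muidx_ind => j a b; rewrite entryM entry0.
rewrite big1 // => t _; rewrite [X in X * _]entry_munit [X in _ * X]entry_munit.
have [ua|_] := eqVneq (muidx a t) u; last by rewrite mul0r.
have [va|_] := eqVneq (muidx t b) v; last by rewrite mulr0.
by case: uv; rewrite -ua -va.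
Qed.

Lemma munit_star u : astar (munit R u) = munit R (flip u).
Proof.
apply: entryP; elim/muidx_ind => j a b; rewrite entry_star.
rewrite [X in Num.conj X]entry_munit [RHS]entry_munit.
rewrite conjC_nat; congr (nat_of_bool _)%:R.
elim/muidx_ind: u => j' p q; have [jj|jj] := eqVneq j j'; last first.
  by rewrite -!tag_eqE /tag_eq /= (negPf jj).
by subst j'; rewrite /flip !muidx_eq andbC.
Qed.

Lemma munit_upper j (p q : 'I_(n j).+1) : (p <= q)%N ->
  upper_triangular (munit R (muidx p q)).
Proof.
move=> pq j' r s sr; rewrite -entryE entry_munit.
have [jj|jj] := eqVneq j' j; last by rewrite -tag_eqE /tag_eq /= (negPf jj).
subst j'; rewrite muidx_eq; have [rp|] := eqVneq r p => //=.
have [sq|] := eqVneq s q => //=.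
by move: sr; rewrite rp sq ltnNge pq.
Qed.

End MatrixUnits.

Section RegularEmbedding.
Variables (R : realType) (k l : nat) (n : 'I_k.+1 -> nat) (m : 'I_l.+1 -> nat).
Variable f : {linear fdalg R n -> fdalg R m}.
Hypothesis f_emb : TAF_embedding f.
Implicit Types (u : munit_idx n) (v : munit_idx m) (x : fdalg R n).

(** By regularity the image of a matrix unit has entries 0 and 1, so a nonzero entry means that v is
    one of the matrix units in the sum. *)
Definition summand u v : bool := entry (f (munit R u)) v != 0.

Lemma entry_f_munit u v : entry (f (munit R u)) v = (summand u v)%:R.
Proof.
case: f_emb => _ _ _ /(_ u)[S fu]; rewrite /summand fu entry_sum.
have -> : \sum_(w in S) entry (munit R w) v = (v \in S)%:R.
  have [vS|vS] := boolP (v \in S).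
    rewrite (bigD1 v) //= [X in X + _]entry_munit eqxx big1 ?addr0 // => w /andP[_ wv].
    by rewrite (entry_munit R w) eq_sym (negPf wv).
  rewrite big1 // => w wS; rewrite (entry_munit R w).
  by have [vw|//] := eqVneq v w; rewrite vw wS in vS.
by case: (v \in S); rewrite ?oner_eq0 ?eqxx.
Qed.

(** The right side counts intermediate indices. Nothing cancels in a count, and comparing it with an
    entry known to be 0 or 1 yields the existence and uniqueness statements below. *)
Lemma entry_f_munitM u1 u2 j (r s : 'I_(m j).+1) :
  entry (f (amul (munit R u1) (munit R u2))) (muidx r s) =
  (\sum_t (summand u1 (muidx r t) && summand u2 (muidx t s)))%:R.
Proof.
case: f_emb => -[fM _] _ _ _; rewrite fM entryM natr_sum; apply: eq_bigr => t _.
by rewrite [X in X * _]entry_f_munit [X in _ * X]entry_f_munit -natrM mulnb.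
Qed.

Lemma summand_mul j (p q t : 'I_(n j).+1) j' (a b c : 'I_(m j').+1) :
  summand (muidx p q) (muidx a b) -> summand (muidx q t) (muidx b c) ->
  summand (muidx p t) (muidx a c).
Proof.
move=> h1 h2; rewrite /summand -(munitM R p q t) entry_f_munitM pnatr_eq0.
by rewrite (bigD1 b) //= h1 h2.
Qed.

Lemma summand_flip u v : summand u v -> summand (flip u) (flip v).
Proof.
case: f_emb => -[_ fS] _ _ _; rewrite /summand -munit_star fS.
by elim/muidx_ind: v => j p q; rewrite entry_star conjC_eq0.
Qed.

Lemma summand_mid u1 u2 j (a b c : 'I_(m j).+1) :
  summand u1 (muidx a b) -> summand u2 (muidx b c) -> ridx u1 = lidx u2.
Proof.
move=> h1 h2; apply: contrapT => /(munitM0 R) e0.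
have := entry_f_munitM u1 u2 a c; rewrite e0 linear0 entry0 => /eqP.
by rewrite eq_sym pnatr_eq0 (bigD1 b) //= h1 h2.
Qed.

Lemma summand_lidx u1 u2 j (a b c : 'I_(m j).+1) :
  summand u1 (muidx a b) -> summand u2 (muidx a c) -> lidx u1 = lidx u2.
Proof. by move=> /summand_flip h1 h2; have := summand_mid h1 h2. Qed.

Lemma summand_ridx u1 u2 j (a b c : 'I_(m j).+1) :
  summand u1 (muidx a c) -> summand u2 (muidx b c) -> ridx u1 = ridx u2.
Proof. by move=> h1 /summand_flip h2; have := summand_mid h1 h2. Qed.

Lemma idx_inj (k' : nat) (n' : 'I_k'.+1 -> nat) (u1 u2 : munit_idx n') :
  lidx u1 = lidx u2 -> ridx u1 = ridx u2 -> u1 = u2.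
Proof.
elim/muidx_ind: u1 => j p q; elim/muidx_ind: u2 => j' r s l_eq.
have jj : j = j' := congr1 tag l_eq.
by subst j' => /ridx_eqP ->; move/lidx_eqP: l_eq => ->.
Qed.

Lemma summand_inj u1 u2 v : summand u1 v -> summand u2 v -> u1 = u2.
Proof.
elim/muidx_ind: v => j a b h1 h2.
by apply: idx_inj; [exact: summand_lidx h1 h2|exact: summand_ridx h1 h2].
Qed.

Lemma summand_refl j (p q : 'I_(n j).+1) j' (a b : 'I_(m j').+1) :
  summand (muidx p q) (muidx a b) -> summand (muidx p p) (muidx a a).
Proof. by move=> h; apply: summand_mul h (summand_flip h). Qed.

(** Two columns b and c would make the count for e_pq e_qp = e_pp at (a, a) at least 2, while that
    entry is at most 1. *)
Lemma summand_fun j (p q : 'I_(n j).+1) j' (a b c : 'I_(m j').+1) :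
  summand (muidx p q) (muidx a b) -> summand (muidx p q) (muidx a c) -> b = c.
Proof.
move=> hb hc; apply/eqP/negPn/negP => bc.
have := entry_f_munitM (muidx p q) (muidx q p) a a.
rewrite munitM (entry_f_munit (muidx p p)) => /eqP; rewrite eqr_nat => /eqP.
rewrite (bigD1 b) //= (bigD1 c) 1?eq_sym //= hb hc.
rewrite (summand_flip hb) (summand_flip hc) /=.
by case: (summand _ _).
Qed.

(** The entry (a, a) of the image of e_pp = e_pt e_tp is 1, so the count of intermediate indices is
    not zero. *)
Lemma summand_ex j (p q t : 'I_(n j).+1) j' (a b : 'I_(m j').+1) :
  summand (muidx p q) (muidx a b) -> exists c, summand (muidx p t) (muidx a c).
Proof.
move=> /summand_refl h; apply: contrapT => /forallNP nc.
have := entry_f_munitM (muidx p t) (muidx t p) a a.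
rewrite munitM (entry_f_munit (muidx p p)) h big1 => [/eqP|c _]; first by rewrite oner_eq0.
by have /negP/negbTE-> := nc c.
Qed.

Lemma summand_upper j (p q : 'I_(n j).+1) j' (a b : 'I_(m j').+1) :
  summand (muidx p q) (muidx a b) -> (p <= q)%N -> (a <= b)%N.
Proof.
move=> h /(munit_upper R) u; rewrite leqNgt; apply/negP => ba.
case: f_emb => _ _ fU _; move: h; rewrite /summand entryE fU ?eqxx //.
by exists (munit R (muidx p q)).
Qed.

Lemma entry_fE x v : entry (f x) v = \sum_u entry x u * (summand u v)%:R.
Proof.
rewrite {1}(fd_decomp x) linear_sum entry_sum; apply: eq_bigr => u _.
rewrite (linearZ_LR f (entry x u) (munit R u)).
by rewrite (entryZ (entry x u) (f (munit R u))) (entry_f_munit u).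
Qed.

Lemma entry_f x v u : summand u v -> entry (f x) v = entry x u.
Proof.
move=> uv; rewrite entry_fE (bigD1 u) //= uv mulr1 big1 ?addr0 // => w wu.
have [wv|_] := boolP (summand w v); last by rewrite mulr0.
by rewrite (summand_inj wv uv) eqxx in wu.
Qed.

Lemma entry_f_neq0 x v : entry (f x) v != 0 ->
  exists2 u, summand u v & entry x u != 0.
Proof.
move=> fx0; have [u uv] : exists u, summand u v.
  apply: contrapT => /forallNP nv; move/eqP: fx0; apply.
  rewrite entry_fE big1 // => u _.
  by have /negP/negbTE-> := nv u; rewrite mulr0.
by exists u => //; move: fx0; rewrite (entry_f x uv).
Qed.

End RegularEmbedding.

Section Track.
Variables (R : realType) (k l : nat) (n : 'I_k.+1 -> nat) (m : 'I_l.+1 -> nat).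
Variable f : {linear fdalg R n -> fdalg R m}.
Hypothesis f_emb : TAF_embedding f.
Variables (u : munit_idx n) (v : munit_idx m).
Local Notation In := 'I_(n (tag u)).+1.
Local Notation Im := 'I_(m (tag v)).+1.
Local Notation p := (tagged u).1.
Local Notation q := (tagged u).2.
Local Notation p' := (tagged v).1.
Local Notation q' := (tagged v).2.

(** The order embedding onto the copy of the summand of u that contains v. The default is never
    reached once [v] is a summand of the image of [u]. *)
Definition track (s : In) : Im :=
  odflt p' [pick t | summand f (muidx p s) (muidx p' t)].

Hypothesis uv : summand f u v.

Let uvE : summand f (muidx p q) (muidx p' q').
Proof. by case: u v uv => [? [? ?]] [? [? ?]]. Qed.

Lemma trackP (s : In) : summand f (muidx p s) (muidx p' (track s)).
Proof.
rewrite /track; case: pickP => //= nt.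
have [t ps] := summand_ex f_emb s uvE.
by rewrite nt in ps.
Qed.

Lemma track_summand (s t : In) : summand f (muidx s t) (muidx (track s) (track t)).
Proof.
exact: (summand_mul f_emb (summand_flip f_emb (trackP s)) (trackP t)).
Qed.

Lemma track_fst : track p = p'.
Proof.
by apply: (summand_fun f_emb (trackP p)); apply: summand_refl uvE.
Qed.

Lemma track_snd : track q = q'.
Proof. exact: (summand_fun f_emb (trackP q) uvE). Qed.

Lemma track_inj : injective track.
Proof.
move=> s t st; have := trackP t; rewrite -st => pt.
exact: ridx_eqP (summand_ridx f_emb (trackP s) pt).
Qed.

Lemma track_lt (s t : In) : (s < t)%N -> (track s < track t)%N.
Proof.
move=> st; rewrite ltn_neqAle (summand_upper f_emb (track_summand s t)) 1?ltnW //.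
rewrite andbT; apply/negP => /eqP/val_inj/track_inj ts.
by rewrite ts ltnn in st.
Qed.

Lemma entry_track x (s t : In) :
  entry (f x) (muidx (track s) (track t)) = entry x (muidx s t).
Proof. exact: entry_f (track_summand s t). Qed.

(** A nonzero entry comes from a matrix unit in row s, so its column is tracked. Upper triangularity
    of x bounds the source column below by s, monotonicity of [track] bounds it above by q. *)
Lemma entry_track_row x (s : In) (t : Im) : upper_triangular x ->
  (s <= q)%N -> (t <= q')%N -> entry (f x) (muidx (track s) t) != 0 ->
  exists2 s' : In, (s <= s' <= q)%N & t = track s'.
Proof.
move=> xU sq tq /(entry_f_neq0 f_emb)[w wt xw0].
have := summand_lidx f_emb wt (track_summand s s).
elim/muidx_ind: w wt xw0 => j a b wt xw0 aE.
have jE : j = tag u := congr1 tag aE.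
subst j; have {}aE := lidx_eqP (aE : lidx (muidx a b) = lidx (muidx s s)).
subst a; have tE := summand_fun f_emb wt (track_summand s b).
exists b => //; apply/andP; split.
  by rewrite leqNgt; apply: contra_neqN xw0; apply: xU.
rewrite leqNgt; apply/negP => /track_lt; rewrite track_snd -tE.
by rewrite ltnNge tq.
Qed.

Lemma entry_track_col x (s : Im) (t : In) : upper_triangular x ->
  (p <= t)%N -> (p' <= s)%N -> entry (f x) (muidx s (track t)) != 0 ->
  exists2 s' : In, (p <= s' <= t)%N & s = track s'.
Proof.
move=> xU pt ps /(entry_f_neq0 f_emb)[w wt xw0].
have := summand_ridx f_emb wt (track_summand t t).
elim/muidx_ind: w wt xw0 => j a b wt xw0 bE.
have jE : j = tag u := congr1 tag bE.
subst j; have {}bE := ridx_eqP (bE : ridx (muidx a b) = ridx (muidx t t)).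
subst b; have sE := summand_fun f_emb (summand_flip f_emb wt) (track_summand t a).
exists a => //; apply/andP; split; last first.
  by rewrite leqNgt; apply: contra_neqN xw0; apply: xU.
rewrite leqNgt; apply/negP => /track_lt; rewrite track_fst -sE.
by rewrite ltnNge ps.
Qed.

End Track.

(** * The tree of minimal entries *)

Section MinimalEntries.
Variables (R : realType) (k : nat -> nat) (n : forall i, 'I_(k i).+1 -> nat).
Arguments n : clear implicits.
Variable phi : forall i, {linear fdalg R (n i) -> fdalg R (n i.+1)}.
Hypothesis phi_emb : forall i, TAF_embedding (phi i).
Variable j : 'I_(k 0).+1.

Definition corner : munit_idx (n 0) := muidx (ord0 : 'I_(n 0 j).+1) ord_max.

Fixpoint corner_image i : fdalg R (n i) :=
  if i is i'.+1 then phi i' (corner_image i') else munit R corner.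

Lemma corner_image_upper i : upper_triangular (corner_image i).
Proof.
elim: i => [|i IH] /=; first exact: munit_upper.
by case: (phi_emb i) => _ _ U _; apply: U; exists (corner_image i).
Qed.

Lemma corner_image_neq0 i : corner_image i != 0.
Proof.
elim: i => [|i /eqP IH] /=; first exact: munit_neq0.
case: (phi_emb i) => _ inj _ _; apply/eqP => e0; apply: IH; apply: inj.
by rewrite e0 linear0.
Qed.

(* Minimality of the interval is inherited by ancestors, which makes the tree of
   minimal entries prunable; a greedy choice at each level would not keep
   the image of the corner matrix unit rank one. *)
Definition minimal_entry i (u : munit_idx (n i)) : Prop :=
  entry (corner_image i) u != 0 /\
  forall r s : 'I_(n i (tag u)).+1, entry (corner_image i) (muidx r s) != 0 ->
    ((tagged u).1 <= r)%N -> (s <= (tagged u).2)%N ->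
    r = (tagged u).1 /\ s = (tagged u).2.

(** An interval of least length is inclusion-minimal. Upper triangularity provides r <= s, without
    which truncated subtraction would not compare lengths. *)
Lemma minimal_entry_ex i : exists u : munit_idx (n i), minimal_entry u.
Proof.
have [u0 u00] : exists u, entry (corner_image i) u != 0.
  apply: contrapT => /forallNP h; have /eqP := corner_image_neq0 i; apply.
  by apply: entryP => u; rewrite entry0; apply/eqP/negPn/negP/h.
pose len (u : munit_idx (n i)) := ((tagged u).2 - (tagged u).1)%N.
case: (arg_minnP (P := fun u => entry (corner_image i) u != 0) len u00) => u.
elim/muidx_ind: u => j' p q pq0 lmin; exists (muidx p q); split=> //= r s rs0 pr sq.
have := lmin _ rs0; rewrite /len /= => qpsr.
have rs : (r <= s)%N.
  by rewrite leqNgt; apply: contra_neqN rs0; apply: corner_image_upper.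
by split; apply/val_inj => /=; lia.
Qed.

(** Tracking is monotone, preserves entries and sends the ends of u to those of v: a nonzero entry
    inside the interval of u reappears inside that of v, where minimality makes it the end pair. *)
Lemma minimal_entry_parent i (v : munit_idx (n i.+1)) : minimal_entry v ->
  exists2 u : munit_idx (n i), minimal_entry u & summand (phi i) u v.
Proof.
move=> [v0 vmin]; have [u uv u0] := entry_f_neq0 (phi_emb i) v0.
exists u => //; split=> // r s rs0 pr sq.
have mono (a b : 'I_(n i (tag u)).+1) : (a <= b)%N ->
    (track (phi i) v a <= track (phi i) v b)%N.
  by move=> /(summand_upper (phi_emb i)); apply; apply: track_summand.
have [] := vmin (track (phi i) v r) (track (phi i) v s).
- by rewrite /= entry_track.
- by rewrite -(track_fst (phi_emb i) uv) mono.
- by rewrite -(track_snd (phi_emb i) uv) mono.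
rewrite -(track_fst (phi_emb i) uv) -(track_snd (phi_emb i) uv).
by move=> /(track_inj (phi_emb i) uv) -> /(track_inj (phi_emb i) uv) ->.
Qed.

Lemma minimal_path : exists w : forall i, munit_idx (n i),
  forall i, minimal_entry (w i) /\ summand (phi i) (w i) (w i.+1).
Proof.
exact: (koenig minimal_entry_ex minimal_entry_parent).
Qed.

End MinimalEntries.

(** * Coherent intervals and the compressions to them *)

Section Tower.
Variables (R : realType) (k : nat -> nat) (n : forall i, 'I_(k i).+1 -> nat).
Arguments n : clear implicits.
Variable phi : forall i, {linear fdalg R (n i) -> fdalg R (n i.+1)}.
Hypothesis phi_emb : forall i, TAF_embedding (phi i).
Variable w : forall i, munit_idx (n i).
Hypothesis w_sub : forall i, summand (phi i) (w i) (w i.+1).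
Hypothesis w0_le : ((tagged (w 0)).1 <= (tagged (w 0)).2)%N.
Local Notation In i := 'I_(n i (tag (w i))).+1.
Local Notation p i := (tagged (w i)).1.
Local Notation q i := (tagged (w i)).2.

Lemma path_le i : (p i <= q i)%N.
Proof.
elim: i => // i IH; have := summand_upper (phi_emb i) _ IH; apply.
by have := w_sub i; case: (w i) (w i.+1) => [? [? ?]] [? [? ?]].
Qed.

(** Positions are plain numbers because the ordinal type changes with the level; [inord] is faithful
    on the interval. *)
Definition ntrack i (a : nat) : nat :=
  track (phi i) (w i.+1) (inord a : In i).

(* An enumeration of the interval [p i, q i] in which the enumeration of each
   level, transported by [ntrack], is a prefix of the next one: a basis vector
   keeps its index at all later levels. *)
Fixpoint points i : seq nat :=
  if i is i'.+1 then
    let s := map (ntrack i') (points i') in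
    s ++ [seq t <- iota (p i'.+1) (q i'.+1 - p i'.+1).+1 | t \notin s]
  else iota (p 0) (q 0 - p 0).+1.

Lemma pointsS i : points i.+1 = map (ntrack i) (points i) ++
  [seq t <- iota (p i.+1) (q i.+1 - p i.+1).+1 | t \notin map (ntrack i) (points i)].
Proof. by []. Qed.

Definition npoints i := size (points i).
Definition place i (a : nat) : nat := nth 0%N (points i) a.

Let mem_interval i a :
  (a \in iota (p i) (q i - p i).+1) = (p i <= a <= q i)%N.
Proof. by rewrite mem_iota; have := path_le i; lia. Qed.

Let interval_bound i (a : nat) : (a <= q i)%N -> (a < (n i (tag (w i))).+1)%N.
Proof. by move=> aq; apply: leq_ltn_trans aq _. Qed.

Let inordq i a : (a <= q i)%N -> (inord a : In i) = a :> nat.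
Proof. by move=> /interval_bound/inordK. Qed.

Let inord_fst i : inord (p i) = p i :> In i.
Proof. by rewrite inord_val. Qed.

Let inord_snd i : inord (q i) = q i :> In i.
Proof. by rewrite inord_val. Qed.

Lemma ntrack_lt i a b : (a < b)%N -> (b <= q i)%N -> (ntrack i a < ntrack i b)%N.
Proof.
by move=> ab bq; apply: (track_lt (phi_emb i) (w_sub i)); rewrite !inordq; lia.
Qed.

Lemma ntrack_fst i : ntrack i (p i) = p i.+1.
Proof. by rewrite /ntrack inord_fst (track_fst (phi_emb i) (w_sub i)). Qed.

Lemma ntrack_snd i : ntrack i (q i) = q i.+1.
Proof. by rewrite /ntrack inord_snd (track_snd (phi_emb i) (w_sub i)). Qed.

Lemma ntrack_le i a b : (a <= b)%N -> (b <= q i)%N -> (ntrack i a <= ntrack i b)%N.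
Proof.
by rewrite leq_eqVlt => /predU1P[->//|ab bq]; rewrite ltnW // ntrack_lt.
Qed.

Lemma mem_points i a : (a \in points i) = (p i <= a <= q i)%N.
Proof.
elim: i a => [|i IH] a; first exact: mem_interval.
rewrite pointsS mem_cat mem_filter mem_interval.
have [|_] //= := boolP (a \in map _ (points i)).
move=> /mapP[b]; rewrite IH => /andP[pb bq] ->.
have := ntrack_le bq (leqnn _); have := ntrack_le pb bq.
by rewrite (ntrack_fst i) (ntrack_snd i) => -> ->.
Qed.

Lemma uniq_points i : uniq (points i).
Proof.
elim: i => [|i IH]; first exact: iota_uniq.
rewrite pointsS cat_uniq filter_uniq ?iota_uniq // andbT map_inj_in_uniq ?IH ?andTb.
  by apply/hasPn => t; rewrite mem_filter => /andP[].
move=> a b; rewrite !mem_points => /andP[_ aq] /andP[_ bq] ab.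
case: (ltngtP a b) => [lt|lt|abE]; last exact: abE.
  by have := ntrack_lt lt bq; rewrite ab ltnn => {ab}.
by have := ntrack_lt lt aq; rewrite ab ltnn => {ab}.
Qed.

Lemma npoints_le i : (npoints i <= npoints i.+1)%N.
Proof. by rewrite /npoints /= size_cat size_map leq_addr. Qed.

Lemma placeP i a : (a < npoints i)%N -> (p i <= place i a <= q i)%N.
Proof. by move=> aN; rewrite -mem_points mem_nth. Qed.

Lemma place_inord i a : (a < npoints i)%N -> (inord (place i a) : In i) = place i a :> nat.
Proof. by move=> /placeP/andP[_ aq]; rewrite inordq. Qed.

Lemma placeS i a : (a < npoints i)%N -> place i.+1 a = ntrack i (place i a).
Proof.
by move=> aN; rewrite /place /= nth_cat size_map aN (nth_map 0%N).
Qed.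

Lemma place_inj i a b : (a < npoints i)%N -> (b < npoints i)%N ->
  place i a = place i b -> a = b.
Proof.
move=> aN bN /eqP; rewrite nth_uniq //; first by move/eqP.
exact: uniq_points.
Qed.

Lemma place_surj i t : (p i <= t <= q i)%N -> exists2 a, (a < npoints i)%N & t = place i a.
Proof.
rewrite -mem_points => tL; exists (index t (points i)); first by rewrite index_mem.
by rewrite /place nth_index.
Qed.

Lemma sum_points (V : nmodType) i (G : In i -> V) :
  (forall t : In i, ~~ (p i <= t <= q i)%N -> G t = 0) ->
  \sum_t G t = \sum_(a < npoints i) G (inord (place i a)).
Proof.
move=> G0; rewrite -(big_mkord xpredT (fun a => G (inord (place i a)))).
rewrite -(big_nth 0%N xpredT (fun a => G (inord a))).
rewrite (bigID (fun t : In i => p i <= t <= q i)%N) /= [X in _ + X]big1 ?addr0 //.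
rewrite (eq_bigr (fun t : In i => G (inord t))) => [|t _]; last by rewrite inord_val.
rewrite -(big_mkord (fun t => p i <= t <= q i)%N (fun t => G (inord t))).
rewrite -big_filter; apply: perm_big; apply: uniq_perm.
- by rewrite filter_uniq // iota_uniq.
- exact: uniq_points.
move=> a; rewrite mem_filter mem_points mem_iota.
by have [/andP[_ /interval_bound]|//] := boolP (p i <= a <= q i)%N; lia.
Qed.

Definition compression i (x : fdalg R (n i)) (a b : nat) : R[i] :=
  entry x (muidx (inord (place i a) : In i) (inord (place i b))).

Let placeS_track i a : (a < npoints i)%N ->
  inord (place i.+1 a) = track (phi i) (w i.+1) (inord (place i a) : In i) :> In i.+1.
Proof. by move=> aN; rewrite placeS // /ntrack inord_val. Qed.

Lemma compression_phi i x a b : (a < npoints i)%N -> (b < npoints i)%N ->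
  compression (phi i x) a b = compression x a b.
Proof.
move=> aN bN; rewrite /compression !placeS_track //.
exact: (entry_track (phi_emb i) (w_sub i)).
Qed.

(** A tracked position carries an old index; hence a new index, at least [npoints i], is never at a
    tracked position. This turns the support lemmas for [track] into block diagonality. *)
Let track_points i (t : In i.+1) (s : In i) b :
  (p i <= s <= q i)%N -> t = track (phi i) (w i.+1) s ->
  t = inord (place i.+1 b) -> (b < npoints i.+1)%N -> (b < npoints i)%N.
Proof.
move=> /place_surj[a aN sE] tE tb bN.
have ab : place i.+1 a = place i.+1 b.
  rewrite placeS // /ntrack -sE inord_val -tE tb place_inord //.
suff -> : b = a by [].
by apply/esym/(@place_inj i.+1) => //; apply: leq_trans aN (npoints_le i).
Qed.

Lemma compression_phi_row i x a b : upper_triangular x ->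
  (a < npoints i)%N -> (npoints i <= b < npoints i.+1)%N ->
  compression (phi i x) a b = 0.
Proof.
move=> xU aN /andP[Nb bN]; apply/eqP/negPn/negP; rewrite /compression (placeS_track aN).
have /andP[pa aq] := placeP aN; have /andP[pb bq] := placeP bN.
move=> /(entry_track_row (phi_emb i) (w_sub i) xU)[].
- by rewrite place_inord.
- by rewrite place_inord.
move=> s; rewrite place_inord // => /andP[as_ sq] sE.
have /track_points/(_ sE erefl bN) : (p i <= s <= q i)%N by rewrite sq (leq_trans pa).
by rewrite ltnNge Nb.
Qed.

Lemma compression_phi_col i x a b : upper_triangular x ->
  (a < npoints i)%N -> (npoints i <= b < npoints i.+1)%N ->
  compression (phi i x) b a = 0.
Proof.
move=> xU aN /andP[Nb bN]; apply/eqP/negPn/negP; rewrite /compression (placeS_track aN).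
have /andP[pa aq] := placeP aN; have /andP[pb bq] := placeP bN.
move=> /(entry_track_col (phi_emb i) (w_sub i) xU)[].
- by rewrite place_inord.
- by rewrite place_inord.
move=> s; rewrite place_inord // => /andP[ps sa] sE.
have /track_points/(_ sE erefl bN) : (p i <= s <= q i)%N by rewrite ps (leq_trans sa).
by rewrite ltnNge Nb.
Qed.

Lemma compression_lower i (x : fdalg R (n i)) a b : upper_triangular x ->
  (a < npoints i)%N -> (b < npoints i)%N -> (place i b < place i a)%N ->
  compression x a b = 0.
Proof.
by move=> xU aN bN ba; apply: xU; rewrite !place_inord.
Qed.

(** Convexity of the interval: for t < p the factor x_at lies below the diagonal, for t > q the
    factor y_tb does, so no t outside contributes. *)
Lemma compressionM i (x y : fdalg R (n i)) a b : upper_triangular x ->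
  upper_triangular y -> (a < npoints i)%N -> (b < npoints i)%N ->
  compression (amul x y) a b = \sum_(d < npoints i) compression x a d * compression y d b.
Proof.
move=> xU yU aN bN; rewrite /compression entryM sum_points // => t.
have /andP[pa aq] := placeP aN; have /andP[pb bq] := placeP bN.
rewrite negb_and -!ltnNge => /orP[tp|qt].
  rewrite (_ : entry x _ = 0) ?mul0r //; apply: xU.
  by rewrite place_inord // (leq_trans tp).
rewrite (_ : entry y _ = 0) ?mulr0 //; apply: yU.
by rewrite place_inord // (leq_ltn_trans bq).
Qed.

Lemma compression_munit i a b : (a < npoints i)%N -> (b < npoints i)%N ->
  (place i a <= place i b)%N ->
  exists2 u : munit_idx (n i), upper_triangular (munit R u) &
    forall c d, (c < npoints i)%N -> (d < npoints i)%N ->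
      compression (munit R u) c d = ((c == a) && (d == b))%:R.
Proof.
move=> aN bN ab.
exists (muidx (inord (place i a) : In i) (inord (place i b))).
  by apply: munit_upper; rewrite !place_inord.
move=> c d cN dN; rewrite /compression entry_munit muidx_eq.
congr (nat_of_bool (_ && _))%:R; apply/eqP/eqP => [/(congr1 val)|-> //].
  by rewrite /= !place_inord //; apply: place_inj.
by rewrite /= !place_inord //; apply: place_inj.
Qed.

Lemma place_ltS i a b : (a < npoints i)%N -> (b < npoints i)%N ->
  (place i.+1 a < place i.+1 b)%N = (place i a < place i b)%N.
Proof.
move=> aN bN; rewrite !placeS //.
have /andP[_ aq] := placeP aN; have /andP[_ bq] := placeP bN.
apply/idP/idP => [|ab]; last exact: ntrack_lt.
by apply: contraTT; rewrite -!leqNgt => ba; apply: ntrack_le.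
Qed.

Lemma npoints0 : npoints 0 = (q 0 - p 0).+1.
Proof. by rewrite /npoints /= size_iota. Qed.

Lemma npoints_gt0 i : (0 < npoints i)%N.
Proof. by elim: i => [|i /leq_trans]; [rewrite npoints0|apply; apply: npoints_le]. Qed.

Lemma npoints0_le i : (npoints 0 <= npoints i)%N.
Proof. by elim: i => // i /leq_trans; apply; apply: npoints_le. Qed.

Lemma place_first i : place i 0 = p i.
Proof.
elim: i => [|i IH]; first by rewrite /place nth_iota ?addn0.
by rewrite placeS ?npoints_gt0 // IH ntrack_fst.
Qed.

(** The greatest element keeps the index it received at level 0, although later levels append larger
    indices for positions in between. *)
Lemma place_last i : place i (npoints 0).-1 = q i.
Proof.
elim: i => [|i IH]; first by rewrite npoints0 /place nth_iota /= ?subnKC.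
rewrite placeS ?IH ?ntrack_snd //; have := npoints0_le i; have := npoints_gt0 0.
by lia.
Qed.

Section Contraction.
Variables (A : cstarAlgType R) (psi : forall i, {linear fdalg R (n i) -> A}).
Hypotheses (psi_hom : forall i, star_hom (psi i)).
Hypotheses (psi_inj : forall i, injective (psi i)).

Lemma compression_contractive i x (f : nat -> R[i]) :
  \sum_(a < npoints i) csq (\sum_(b < npoints i) compression x a b * f b) <=
  rnorm (psi i x) ^+ 2 * \sum_(a < npoints i) csq (f a).
Proof.
(* f is transported to the interval and extended by zero to the whole summand; the compression is
   then the restriction of x v to the interval. *)
pose v : 'cV[R[i]]_(n i (tag (w i))).+1 :=
  \col_t (if (p i <= t <= q i)%N then f (index (val t) (points i)) else 0).
have vE a : (a < npoints i)%N -> v (inord (place i a)) 0 = f a.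
  move=> aN; rewrite mxE /= place_inord // placeP //.
  by rewrite /place index_uniq // uniq_points.
have v0 (t : In i) : ~~ (p i <= t <= q i)%N -> v t 0 = 0.
  by move=> /negbTE h; rewrite mxE h.
have -> : \sum_(a < npoints i) csq (f a) = csqv v.
  rewrite /csqv sum_points => [|t /v0->]; last exact: csq0.
  by apply: eq_bigr => a _; rewrite vE.
apply: le_trans (csqv_le_rnorm (psi_hom i) (@psi_inj i) x v).
rewrite /csqv; pose G (t : In i) : R :=
  if (p i <= t <= q i)%N then csq ((x (tag (w i)) *m v) t 0) else 0.
apply: (@le_trans _ _ (\sum_t G t)); last first.
  by apply: ler_sum => t _; rewrite /G; case: ifP => // _; apply: csq_ge0.
rewrite sum_points => [|t /negbTE h]; last by rewrite /G h.
apply: ler_sum => a _; rewrite /G place_inord // placeP // mxE.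
rewrite sum_points => [|t /v0->]; last by rewrite mulr0.
by under [X in _ <= csq X]eq_bigr => b _ do rewrite vE //.
Qed.

End Contraction.
End Tower.

(** * Representations from compatible compressions *)

Section DenseExtension.
Variables (R : realType) (A : normedModType R[i]) (H : completeNormedModType R[i]).
Variables (B : set A) (S : A -> {linear H -> H}).

Lemma eps_eq0 (v : H) (K : R) :
  (forall e, 0 < e -> e <= 1 -> rnorm v <= K * e) -> v = 0.
Proof.
move=> h; apply: rnorm_eq0; apply/eqP; rewrite eq_le rnorm_ge0 andbT.
apply/ler_addgt0Pr => e e0; rewrite add0r.
have K0 : 0 <= K by have := h 1 ltr01 (lexx 1); rewrite mulr1; apply: le_trans (rnorm_ge0 v).
(* The denominator K + 1 stays positive when K = 0; the cap at 1 meets the side condition of the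
   hypothesis. *)
pose d := Num.min 1 (e / (K + 1)).
have K1 : 0 < K + 1 by rewrite ltr_wpDl.
have d0 : 0 < d by rewrite lt_min ltr01 divr_gt0.
have d1 : d <= 1 by rewrite ge_min lexx.
apply: le_trans (h d d0 d1) _.
apply: (@le_trans _ _ (K * (e / (K + 1)))).
  by rewrite ler_wpM2l // ge_min lexx orbT.
by rewrite mulrCA ler_piMr ?(ltW e0) // ler_pdivrMr // mul1r lerDl.
Qed.

Lemma closure_rnorm_le (v : A) (K : R) :
  (forall e, 0 < e -> e <= 1 -> exists2 w, B w & rnorm (v - w) <= K * e) ->
  closure B v.
Proof.
move=> h; apply/closure_rnormP => e e0.
have K0 : 0 <= K.
  have [w _] := h 1 ltr01 (lexx 1); rewrite mulr1; apply: le_trans.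
  exact: rnorm_ge0.
have K1 : 0 < K + 1 by rewrite ltr_wpDl.
pose d := Num.min 1 (e / (K + 1)).
have d0 : 0 < d by rewrite lt_min ltr01 divr_gt0.
have d1 : d <= 1 by rewrite ge_min lexx.
have [w Bw vw] := h d d0 d1; exists w => //; apply: le_lt_trans vw _.
apply: (@lt_le_trans _ _ ((K + 1) * d)); first by rewrite ltr_pM2r // ltrDl.
by rewrite mulrC -ler_pdivlMr // ge_min lexx orbT.
Qed.

Hypothesis S_bound : forall a b x, B a -> B b ->
  rnorm (S a x - S b x) <= rnorm (a - b) * rnorm x.

(** T is a pointwise limit along a sequence of B tending to a. The estimate is stated against every
    b in B, since linearity, multiplicativity and contractivity of the extension are all deduced
    from it. *)
Lemma dense_extension_at a : closure B a -> exists T : {linear H -> H},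
  forall b x, B b -> rnorm (T x - S b x) <= rnorm (a - b) * rnorm x.
Proof.
move=> /closure_rnormP aB.
have /choice[b bP] : forall i : nat, exists b, B b /\ rnorm (a - b) < i.+1%:R^-1.
  by move=> i; have [|b Bb ab] := aB (i.+1%:R^-1); [rewrite invr_gt0|exists b].
have bB i : B (b i) by have [] := bP i.
have bb i j c : B c -> (i <= j)%N ->
    rnorm (c - b j) <= rnorm (c - a) + i.+1%:R^-1.
  move=> Bc ij; rewrite (_ : c - b j = (c - a) + (a - b j)); last by rewrite addrA subrK.
  apply: le_trans (rnormD _ _) _; rewrite lerD2l ltW // (lt_le_trans (bP j).2) //.
  by rewrite lef_pV2 ?posrE // ler_nat.
have bb2 i j : (i <= j)%N -> rnorm (b i - b j) <= 2 * i.+1%:R^-1.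
  move=> ij; apply: le_trans (bb _ _ _ (bB i) ij) _.
  by rewrite rnormB mulr_natl mulr2n lerD2r ltW // (bP i).2.
have cau x : cvg ((fun i => S (b i) x) @ \oo).
  apply/cauchy_cvgP/cauchyP => e e0.
  have eE : (complex.Re e)%:C%C = e by rewrite RRe_ge0 // ltW.
  have r0 : 0 < complex.Re e by rewrite -ltcR eE.
  rewrite -eE; set r := complex.Re e in r0 *.
  (* Makes 2 ||x|| / (i + 1) < r, the Cauchy estimate coming from [bb2]. *)
  pose i := Num.bound (2 * (rnorm x + 1) / r).
  exists (S (b i) x); exists i => // j /= ij; rewrite rnorm_ball //=.
  apply: le_lt_trans (S_bound _ (bB i) (bB j)) _.
  apply: (@le_lt_trans _ _ (2 * i.+1%:R^-1 * rnorm x)).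
    by rewrite ler_wpM2r ?rnorm_ge0 ?bb2.
  have := archi_boundP (x := 2 * (rnorm x + 1) / r).
  rewrite -/i divr_ge0 ?mulr_ge0 ?addr_ge0 ?rnorm_ge0 ?(ltW r0) // => /(_ isT).
  rewrite ltr_pdivrMr // => hi.
  rewrite mulrAC ltr_pdivrMr ?ltr0n // mulrC.
  have := rnorm_ge0 x; have : i%:R <= i.+1%:R :> R by rewrite ler_nat.
  by move=> hii x0; nra.
pose T x := lim ((fun i => S (b i) x) @ \oo).
have T_lin : linear T.
  move=> c x y; apply: cvg_lim => //.
  have -> : (fun i => S (b i) (c *: x + y)) =
      (fun i => c *: S (b i) x + S (b i) y) by apply/funext => i; rewrite linearP.
  by apply: cvgD; [apply: cvgZr|]; exact: cau.
pose Tl := GRing.isLinear.Build _ _ _ _ T T_lin.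
pose T' : {linear H -> H} := HB.pack T Tl.
exists T' => c x Bc; apply/ler_addgt0Pr => e e0.
have [i0 _ i0P] : \forall i \near \oo, ball (T x) (e / 2)%:C%C (S (b i) x).
  by move/cvg_ballP: (cau x); apply; rewrite ltcR divr_gt0.
pose i1 := Num.bound (2 * (rnorm x + 1) / e).
pose i := maxn i0 i1.
rewrite (_ : T' x - S c x = (T x - S (b i) x) + (S (b i) x - S c x)); last first.
  by rewrite addrA subrK.
apply: le_trans (rnormD _ _) _.
have h1 : rnorm (T x - S (b i) x) < e / 2.
  by have := i0P i (leq_maxl _ _); rewrite /= rnorm_ball ?divr_gt0.
have h2 : rnorm (S (b i) x - S c x) <= (rnorm (a - c) + i1.+1%:R^-1) * rnorm x.
  apply: le_trans (S_bound _ (bB i) Bc) _; rewrite ler_wpM2r ?rnorm_ge0 //.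
  by rewrite rnormB [rnorm (a - c)]rnormB bb // leq_maxr.
have h3 : i1.+1%:R^-1 * rnorm x <= e / 2.
  have := archi_boundP (x := 2 * (rnorm x + 1) / e).
  rewrite -/i1 divr_ge0 ?mulr_ge0 ?addr_ge0 ?rnorm_ge0 ?(ltW e0) // => /(_ isT).
  rewrite ltr_pdivrMr // => hi.
  rewrite mulrC ler_pdivrMr ?ltr0n //.
  have := rnorm_ge0 x; have : i1%:R <= i1.+1%:R :> R by rewrite ler_nat.
  by move=> hii x0; nra.
rewrite mulrDl in h2; apply: le_trans (lerD (ltW h1) h2) _.
by rewrite addrCA lerD2l [leRHS](splitr e) lerD2l.
Qed.

Lemma dense_extension : exists rho : A -> {linear H -> H}, forall a b x,
  closure B a -> B b -> rnorm (rho a x - S b x) <= rnorm (a - b) * rnorm x.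
Proof.
have /choice[rho rhoP] : forall a, exists T : {linear H -> H}, closure B a ->
    forall b x, B b -> rnorm (T x - S b x) <= rnorm (a - b) * rnorm x.
  move=> a; have [/dense_extension_at[T TP]|na] := pselect (closure B a).
    by exists T.
  by exists (S a).
by exists rho => a b x aB; apply: rhoP.
Qed.

End DenseExtension.

Section L2Vectors.
Variables (R : realType) (D : set nat).
Local Notation H := (l2 R D).
Implicit Types (x y : nat) (xi : H).

Lemma l2_ext (f : nat -> R[i]) (K : R) : (forall x, ~ D x -> f x = 0) ->
  (forall n, sqsum f n <= K) -> exists xi : H, forall x, xi x = f x.
Proof.
by move=> f0 fK; have fl2 : f \in @l2_pred R D by [apply/l2_predP; split=> //; exists K];
   exists (L2 fl2).
Qed.

Lemma l2_trunc_ex xi n : exists eta : H, forall x, eta x = if (x < n)%N then xi x else 0.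
Proof.
have [K xiK] := l2_bounded xi; apply: (@l2_ext _ K) => [x nD|m].
  by rewrite (l2_supp xi nD); case: ifP.
by apply: le_trans (xiK m); apply: ler_sum => x _; case: ifP; rewrite // csq0 csq_ge0.
Qed.

Definition l2_trunc xi n : H := sval (cid (l2_trunc_ex xi n)).

Lemma l2_truncE xi n x : l2_trunc xi n x = if (x < n)%N then xi x else 0.
Proof. exact: (svalP (cid (l2_trunc_ex xi n))). Qed.

Lemma l2_delta_ex y : exists eta : H, forall x,
  eta x = if `[< D y >] && (x == y) then 1 else 0.
Proof.
apply: (@l2_ext _ 1) => [x nD|n].
  by case: ifP => // /andP[/asboolP Dy /eqP xy]; rewrite xy in nD.
case: (boolP (y < n)%N) => [yn|yn].
  rewrite /sqsum (bigD1 (Ordinal yn)) //= big1 => [|i iy].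
    by rewrite addr0; case: ifP => _; rewrite ?csq1 ?csq0.
  case: ifP => [/andP[_ /eqP yi]|_]; last by rewrite csq0.
  by case/eqP: iy; apply/val_inj.
rewrite /sqsum big1 // => i _; case: ifP => [/andP[_ /eqP yi]|_]; last by rewrite csq0.
by rewrite -yi ltn_ord in yn.
Qed.

(** The zero vector for y outside [D], which makes the definition total. *)
Definition l2_delta y : H := sval (cid (l2_delta_ex y)).

Lemma l2_deltaE y x : D y -> l2_delta y x = (x == y)%:R.
Proof.
move=> Dy; rewrite (svalP (cid (l2_delta_ex y))).
by move/asboolP: Dy => -> /=; case: eqP.
Qed.

Lemma hdot_delta xi y : D y -> hdot xi (l2_delta y) = xi y.
Proof.
move=> Dy; rewrite l2_hdotE /csum.
rewrite !(@rsum_single _ y) => [|x xy|x xy]; first last.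
- by rewrite l2_deltaE // (negPf xy) conjC0 mulr0.
- by rewrite l2_deltaE // (negPf xy) conjC0 mulr0.
by rewrite l2_deltaE // eqxx conjC1 mulr1; case: (xi y).
Qed.

Lemma sum_ord_if (V : nmodType) (F : nat -> V) m n : (m <= n)%N ->
  \sum_(x < m) F x = \sum_(x < n) if (x < m)%N then F x else 0.
Proof. by move=> mn; rewrite (big_ord_widen _ _ mn) big_mkcond. Qed.

Lemma sqsum_mono (f : nat -> R[i]) m n : (m <= n)%N -> sqsum f m <= sqsum f n.
Proof.
move=> mn; rewrite /sqsum (sum_ord_if (fun x => csq (f x)) mn).
by apply: ler_sum => x _; case: ifP => // _; apply: csq_ge0.
Qed.

Lemma rnorm_l2_trunc_le xi n :
  rnorm (xi - l2_trunc xi n) ^+ 2 <= rnorm xi ^+ 2 - sqsum xi n.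
Proof.
rewrite l2_rnormE; apply: rsum_le => [|m]; first exact: sqsum_summable.
apply: (@le_trans _ _ (sqsum xi (maxn n m) - sqsum xi n)); last first.
  by rewrite lerD2r sqsum_le_rnorm.
apply: (@le_trans _ _ (sqsum (xi - l2_trunc xi n : H) (maxn n m))).
  exact/sqsum_mono/leq_maxr.
rewrite lerBrDr /sqsum (sum_ord_if (fun x => csq (xi x)) (leq_maxl n m)) -big_split /=.
apply: ler_sum => x _.
apply: (@le_trans _ _ (csq (xi x - l2_trunc xi n x) +
  (if (x < n)%N then csq (xi x) else 0))) => //; rewrite l2_truncE.
by case: ifP => _; rewrite ?subrr ?csq0 ?add0r ?subr0 ?addr0.
Qed.

Lemma sqsum_approx xi (e : R) : 0 < e ->
  exists K, rnorm xi ^+ 2 - sqsum xi K < e ^+ 2.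
Proof.
move=> e0; apply: contrapT => /forallNP h.
have : rnorm xi ^+ 2 <= rnorm xi ^+ 2 - e ^+ 2.
  rewrite [leLHS]l2_rnormE; apply: rsum_le => [|n]; first exact: sqsum_summable.
  by have /negP := h n; rewrite -leNgt -/(sqsum xi n); lra.
by rewrite lerBrDr gerDl leNgt exprn_gt0.
Qed.

End L2Vectors.

(* [M i a] is the matrix, on the basis vectors [x < N i], of the compression of an
   element [a] of the i-th algebra [B i], and [pt i x] is the position of [x] in
   the linear order of these basis vectors. *)
Section CompressionSystem.
Variables (R : realType) (A : cstarAlgType R).
Variables (N : nat -> nat) (B : nat -> set A) (M : nat -> A -> nat -> nat -> R[i]).
Variable pt : nat -> nat -> nat.
Hypothesis N_le : forall i, (N i <= N i.+1)%N.
Hypothesis N_gt0 : (0 < N 0)%N.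
Hypothesis B_sub : forall i, B i `<=` B i.+1.
Hypothesis B_lin : forall i (c : R[i]) a b, B i a -> B i b -> B i (c *: a + b).
Hypothesis B_mul : forall i a b, B i a -> B i b -> B i (amul a b).
Hypothesis M_lin : forall i (c : R[i]) a b x y, B i a -> B i b ->
  M i (c *: a + b) x y = c * M i a x y + M i b x y.
Hypothesis M_mul : forall i a b x y, B i a -> B i b -> (x < N i)%N -> (y < N i)%N ->
  M i (amul a b) x y = \sum_(z < N i) M i a x z * M i b z y.
Hypothesis M_succ : forall i a x y, B i a -> (x < N i)%N -> (y < N i)%N ->
  M i.+1 a x y = M i a x y.
Hypothesis M_row : forall i a x y, B i a -> (x < N i)%N ->
  (N i <= y < N i.+1)%N -> M i.+1 a x y = 0.
Hypothesis M_col : forall i a x y, B i a -> (x < N i)%N ->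
  (N i <= y < N i.+1)%N -> M i.+1 a y x = 0.
Hypothesis M_contr : forall i a (f : nat -> R[i]), B i a ->
  \sum_(x < N i) csq (\sum_(y < N i) M i a x y * f y) <=
  rnorm a ^+ 2 * \sum_(x < N i) csq (f x).

Definition index_set : set nat := [set x | exists i, (x < N i)%N].
Local Notation H := (l2 R index_set).
Implicit Types (a b : A) (xi eta : H).

Definition union_alg : set A := \bigcup_i B i.
Local Notation U := union_alg.

Lemma N_mono i j : (i <= j)%N -> (N i <= N j)%N.
Proof. by apply: (homo_leq leqnn leq_trans) => k. Qed.

Lemma B_mono i j : (i <= j)%N -> B i `<=` B j.
Proof.
elim: j => [|j IH]; first by rewrite leqn0 => /eqP->.
rewrite leq_eqVlt => /predU1P[->//|]; rewrite ltnS => /IH ij.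
exact: subset_trans ij (@B_sub j).
Qed.

Lemma index_set_N i x : (x < N i)%N -> index_set x.
Proof. by exists i. Qed.

Lemma M_mono i j a x y : (i <= j)%N -> B i a -> (x < N i)%N -> (y < N i)%N ->
  M j a x y = M i a x y.
Proof.
move=> ij Ba xN yN; elim: j ij => [|j IH]; first by rewrite leqn0 => /eqP->.
rewrite leq_eqVlt => /predU1P[->//|]; rewrite ltnS => ij.
rewrite M_succ ?IH //; first exact: (B_mono ij).
  exact: leq_trans xN (N_mono ij).
exact: leq_trans yN (N_mono ij).
Qed.

Lemma M_row_mono i j a x y : (i <= j)%N -> B i a -> (x < N i)%N ->
  (N i <= y < N j)%N -> M j a x y = 0.
Proof.
move=> ij Ba xN; elim: j ij => [|j IH]; first by rewrite leqn0 => /eqP->; lia.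
rewrite leq_eqVlt => /predU1P[->|]; first by lia.
rewrite ltnS => ij /andP[iy yj].
have xj := leq_trans xN (N_mono ij); have Bj := B_mono ij Ba.
have [yN|yN] := ltnP y (N j); last by rewrite M_row ?yN.
by rewrite M_succ ?IH ?iy.
Qed.

Lemma M_col_mono i j a x y : (i <= j)%N -> B i a -> (x < N i)%N ->
  (N i <= y < N j)%N -> M j a y x = 0.
Proof.
move=> ij Ba xN; elim: j ij => [|j IH]; first by rewrite leqn0 => /eqP->; lia.
rewrite leq_eqVlt => /predU1P[->|]; first by lia.
rewrite ltnS => ij /andP[iy yj].
have xj := leq_trans xN (N_mono ij); have Bj := B_mono ij Ba.
have [yN|yN] := ltnP y (N j); last by rewrite M_col ?yN.
by rewrite M_succ ?IH ?iy.
Qed.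

Definition act i a (f : nat -> R[i]) x : R[i] := \sum_(y < N i) M i a x y * f y.

(** Vanishing of the new columns in old rows makes every row of the infinite matrix of a finite, so
    its action needs no convergence. *)
Lemma act_mono i j a f x : (i <= j)%N -> B i a -> (x < N i)%N ->
  act j a f x = act i a f x.
Proof.
move=> ij Ba xN; rewrite /act (sum_ord_if (fun y => M i a x y * f y) (N_mono ij)).
apply: eq_bigr => y _; case: ifP => [yN|/negbT]; first by rewrite (M_mono ij).
by rewrite -leqNgt => yN; rewrite (M_row_mono ij) ?mul0r ?yN /=.
Qed.

Lemma index_bound i m : exists2 j, (i <= j)%N &
  forall x, (x < m)%N -> index_set x -> (x < N j)%N.
Proof.
elim: m => [|m [j ij jP]]; first by exists i.
have [[l ml]|nm] := pselect (index_set m); last first.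
  exists j => // x; rewrite ltnS leq_eqVlt => /predU1P[->//|]; exact: jP.
exists (maxn j l) => [|x]; first by rewrite (leq_trans ij) // leq_maxl.
rewrite ltnS leq_eqVlt => /predU1P[->|xm Dx].
  by move=> _; apply: leq_trans ml (N_mono (leq_maxr _ _)).
exact: leq_trans (jP x xm Dx) (N_mono (leq_maxl _ _)).
Qed.

Lemma act_l2 i a xi : B i a -> exists eta, (forall j x, (i <= j)%N -> (x < N j)%N ->
  eta x = act j a xi x) /\ rnorm eta <= rnorm a * rnorm xi.
Proof.
(* [lev x] is some level containing the index x, with default 0 off the index set. *)
move=> Ba; pose lev x := xget 0%N [set j | (x < N j)%N].
have levP x : index_set x -> (x < N (lev x))%N.
  by case=> j xj; rewrite /lev; case: xgetP => [j' _ //|/(_ j)].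
pose f x : R[i] := if `[< index_set x >] then act (maxn i (lev x)) a xi x else 0.
have fE j x : (i <= j)%N -> (x < N j)%N -> f x = act j a xi x.
  move=> ij xN; have Dx := index_set_N xN; rewrite /f asboolT //.
  have im := leq_maxl i (lev x); have Bm := B_mono im Ba; have Bj := B_mono ij Ba.
  rewrite -(act_mono _ (leq_maxl _ j)) //; last first.
    exact: leq_trans (levP x Dx) (N_mono (leq_maxr _ _)).
  by rewrite (act_mono _ (leq_maxr _ _)).
have fK m : sqsum f m <= (rnorm a * rnorm xi) ^+ 2.
  (* All coordinates below m are computed at one level j, where contractivity applies to the first
     [N j] coordinates of xi. *)
  have [j ij jP] := index_bound i m; have Bj := B_mono ij Ba.
  apply: (@le_trans _ _ (\sum_(x < m) if (x < N j)%N then csq (act j a xi x) else 0)).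
    apply: ler_sum => x _; case: ifP => [xN|xN]; first by rewrite (fE j).
    rewrite /f; case: asboolP => [Dx|_]; last by rewrite csq0.
    by rewrite jP in xN.
  apply: (@le_trans _ _ (\sum_(x < N j) csq (act j a xi x))).
    apply: (@le_trans _ _ (\sum_(x < maxn m (N j))
        if (x < N j)%N then csq (act j a xi x) else 0)).
      rewrite (sum_ord_if (fun x => if (x < N j)%N then csq (act j a xi x) else 0)
        (leq_maxl m (N j))).
      by apply: ler_sum => x _; case: ifP => // _; case: ifP => // _; apply: csq_ge0.
    by rewrite -(sum_ord_if (fun x => csq (act j a xi x)) (leq_maxr m (N j))).
  apply: le_trans (M_contr xi Bj) _; rewrite exprMn ler_wpM2l ?sqr_ge0 //.
  exact: sqsum_le_rnorm.
have [|eta etaE] := @l2_ext R index_set f _ _ fK.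
  by move=> x nD; rewrite /f asboolF.
exists eta; split=> [j x ij xN|]; first by rewrite etaE (fE j).
apply: rnorm_le_sqsum => [|m]; first by rewrite mulr_ge0 ?rnorm_ge0.
by apply: le_trans (fK m); apply: ler_sum => x _; rewrite etaE.
Qed.

Lemma act_linear i a x : linear_for *%R (act i a ^~ x : (nat -> R[i]) -> R[i]).
Proof.
move=> c f g; rewrite /act mulr_sumr -big_split /=; apply: eq_bigr => y _.
by rewrite !fctE /= mulrDr mulrCA.
Qed.

(** One operator has to serve all levels containing a; the identity is a junk value for elements
    outside the union. *)
Lemma act_op_ex a : exists T : {linear H -> H}, forall i, B i a -> forall xi,
  (forall x, (x < N i)%N -> T xi x = act i a xi x) /\ rnorm (T xi) <= rnorm a * rnorm xi.
Proof.
have [[i0 _ Ba]|na] := pselect (U a); last first.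
  by exists idfun => i Ba; case: na; exists i.
have /choice[T TP] := fun xi => act_l2 xi Ba.
have TE i xi x : B i a -> (x < N i)%N -> T xi x = act i a xi x.
  move=> Bi xN; have im := leq_maxr i0 i.
  have [TPx _] := TP xi.
  rewrite (TPx _ _ (leq_maxl i0 i)); last exact: leq_trans xN (N_mono im).
  by rewrite (act_mono _ im).
have T_lin : linear T.
  move=> c xi eta; apply: l2P => x; rewrite l2E.
  have [[j xj]|nD] := pselect (index_set x); last by rewrite !(l2_supp _ nD) mulr0 addr0.
  have Bm := B_mono (leq_maxl i0 j) Ba; have xm := leq_trans xj (N_mono (leq_maxr i0 j)).
  by rewrite !(TE (maxn i0 j)) // -act_linear.
pose Tl := GRing.isLinear.Build _ _ _ _ T T_lin.
pose T' : {linear H -> H} := HB.pack T Tl.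
by exists T' => i Bi xi; split=> [x|]; [exact: TE|by have [] := TP xi].
Qed.

Definition act_op a : {linear H -> H} := sval (cid (act_op_ex a)).

Lemma act_opE i a xi x : B i a -> (x < N i)%N -> act_op a xi x = act i a xi x.
Proof. by move=> Ba xN; have [+ _] := svalP (cid (act_op_ex a)) i Ba xi; apply. Qed.

Lemma act_op_le a xi : U a -> rnorm (act_op a xi) <= rnorm a * rnorm xi.
Proof. by case=> i _ Ba; have [] := svalP (cid (act_op_ex a)) i Ba xi. Qed.

Lemma U2 a b : U a -> U b -> exists i, B i a /\ B i b.
Proof.
move=> [i _ Ba] [j _ Bb]; exists (maxn i j).
by split; [apply: (B_mono (leq_maxl i j))|apply: (B_mono (leq_maxr i j))].
Qed.

Lemma act_op_ext a xi eta i : B i a ->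
  (forall j x, (i <= j)%N -> (x < N j)%N -> act j a xi x = eta x) -> act_op a xi = eta.
Proof.
move=> Ba h; apply: l2P => x.
have [[j xj]|nD] := pselect (index_set x); last by rewrite !(l2_supp _ nD).
have xm := leq_trans xj (N_mono (leq_maxr i j)); have im := leq_maxl i j.
by rewrite (act_opE _ (B_mono im Ba)) // h.
Qed.

Lemma act_op_lin c a b xi : U a -> U b ->
  act_op (c *: a + b) xi = c *: act_op a xi + act_op b xi.
Proof.
move=> Ua Ub; have [i [Ba Bb]] := U2 Ua Ub.
apply: (act_op_ext (B_lin c Ba Bb)) => j x ij xN; rewrite l2E.
have Ba' := B_mono ij Ba; have Bb' := B_mono ij Bb.
rewrite (act_opE _ Ba') // (act_opE _ Bb') // /act mulr_sumr -big_split /=.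
by apply: eq_bigr => y _; rewrite M_lin // mulrDl mulrA.
Qed.

Lemma act_op_mul a b xi : U a -> U b ->
  act_op (amul a b) xi = act_op a (act_op b xi).
Proof.
move=> Ua Ub; have [i [Ba Bb]] := U2 Ua Ub.
apply: (act_op_ext (B_mul Ba Bb)) => j x ij xN.
have Ba' := B_mono ij Ba; have Bb' := B_mono ij Bb.
rewrite (act_opE _ Ba') // /act.
under eq_bigr => y _ do rewrite M_mul // mulr_suml.
rewrite exchange_big /=; apply: eq_bigr => z _.
rewrite (act_opE _ Bb') // /act mulr_sumr.
by apply: eq_bigr => y _; rewrite mulrA.
Qed.

Lemma U_lin c a b : U a -> U b -> U (c *: a + b).
Proof. by move=> Ua Ub; have [i [Ba Bb]] := U2 Ua Ub; exists i => //; apply: B_lin. Qed.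

Lemma U_mul a b : U a -> U b -> U (amul a b).
Proof. by move=> Ua Ub; have [i [Ba Bb]] := U2 Ua Ub; exists i => //; apply: B_mul. Qed.

Lemma act_op_bound a b xi : U a -> U b ->
  rnorm (act_op a xi - act_op b xi) <= rnorm (a - b) * rnorm xi.
Proof.
move=> Ua Ub; have abE : a - b = -1 *: b + a by rewrite scaleN1r addrC.
have -> : act_op a xi - act_op b xi = act_op (a - b) xi.
  by rewrite abE act_op_lin // scaleN1r addrC.
by apply: act_op_le; rewrite abE; apply: U_lin.
Qed.

Definition rep : A -> {linear H -> H} := sval (cid (dense_extension act_op_bound)).

Lemma rep_approx a b xi : closure U a -> U b ->
  rnorm (rep a xi - act_op b xi) <= rnorm (a - b) * rnorm xi.
Proof. exact: (svalP (cid (dense_extension act_op_bound))). Qed.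

Lemma rep_act a xi : U a -> rep a xi = act_op a xi.
Proof.
move=> Ua; apply/eqP; rewrite -subr_eq0; apply/eqP/rnorm_eq0/eqP.
rewrite eq_le rnorm_ge0 andbT; have := rep_approx xi (subset_closure Ua) Ua.
by rewrite subrr rnorm0 mul0r.
Qed.

Lemma closure_approx a (e : R) : closure U a -> 0 < e -> exists2 b, U b & rnorm (a - b) <= e.
Proof.
by move=> /closure_rnormP h /h[b Ub ab]; exists b => //; apply: ltW.
Qed.

Lemma closure_lin c a b : closure U a -> closure U b -> closure U (c *: a + b).
Proof.
move=> ca cb; apply: (@closure_rnorm_le _ _ _ _ (Num.sqrt (csq c) + 1)) => e e0 _.
have [a' Ua aa] := closure_approx ca e0; have [b' Ub bb] := closure_approx cb e0.
exists (c *: a' + b'); first exact: U_lin.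
rewrite opprD addrACA -scalerBr; apply: le_trans (rnormD _ _) _.
by rewrite rnormZ mulrDl mul1r lerD // ler_wpM2l ?sqrtr_ge0.
Qed.

Lemma amulBl (a b c : A) : amul (a - b) c = amul a c - amul b c.
Proof. by rewrite addrC -scaleN1r amul_linearl scaleN1r addrC. Qed.

Lemma amulBr (a b c : A) : amul c (a - b) = amul c a - amul c b.
Proof. by rewrite addrC -scaleN1r amul_linearr scaleN1r addrC. Qed.

Lemma rnorm_amulB (a b a' b' : A) (e : R) : rnorm (a - a') <= e -> rnorm (b - b') <= e ->
  e <= 1 -> rnorm (amul a b - amul a' b') <= (rnorm b + rnorm a + 1) * e.
Proof.
move=> aa bb e1; have e0 : 0 <= e := le_trans (rnorm_ge0 _) aa.
have -> : amul a b - amul a' b' = amul (a - a') b + amul a' (b - b').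
  by rewrite amulBl amulBr addrA subrK.
have a'a : rnorm a' <= rnorm a + 1.
  rewrite -[a'](subrK a); apply: le_trans (rnormD _ _) _.
  by rewrite addrC lerD2l rnormB (le_trans aa).
apply: le_trans (rnormD _ _) _; rewrite -addrA mulrDl lerD //.
  by apply: le_trans (rnorm_amul _ _) _; rewrite mulrC ler_wpM2l ?rnorm_ge0.
by apply: le_trans (rnorm_amul _ _) _; rewrite ler_pM ?rnorm_ge0.
Qed.

Lemma closure_mul a b : closure U a -> closure U b -> closure U (amul a b).
Proof.
move=> ca cb; apply: (@closure_rnorm_le _ _ _ _ (rnorm b + rnorm a + 1)) => e e0 e1.
have [a' Ua aa] := closure_approx ca e0; have [b' Ub bb] := closure_approx cb e0.
by exists (amul a' b'); [exact: U_mul|exact: rnorm_amulB].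
Qed.

Lemma rep_le a xi : closure U a -> rnorm (rep a xi) <= rnorm a * rnorm xi.
Proof.
move=> ca; apply/ler_addgt0Pr => e e0.
(* The error d ||xi|| occurs twice, once for [rep a] against [act_op b] and once for ||b|| against
   ||a||. *)
pose d := e / (2 * (rnorm xi + 1)).
have x1 : 0 < rnorm xi + 1 by rewrite ltr_wpDl ?rnorm_ge0.
have d0 : 0 < d by rewrite divr_gt0 // mulr_gt0.
have [b Ub ab] := closure_approx ca d0.
rewrite -[rep a xi](subrK (act_op b xi)); apply: le_trans (rnormD _ _) _.
have h1 := le_trans (rep_approx xi ca Ub) (ler_wpM2r (rnorm_ge0 xi) ab).
have bn : rnorm b <= rnorm a + d.
  by rewrite -[b](subrK a) addrC; apply: le_trans (rnormD _ _) _; rewrite lerD2l rnormB.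
have h2 := le_trans (act_op_le xi Ub) (ler_wpM2r (rnorm_ge0 xi) bn).
have dx : d * rnorm xi <= e / 2.
  rewrite (_ : d * _ = e / 2 * (rnorm xi / (rnorm xi + 1))); last first.
    by rewrite /d invfM; ring.
  by rewrite ler_piMr ?divr_ge0 ?(ltW e0) // ler_pdivrMr // mul1r lerDl.
apply: le_trans (lerD h1 h2) _; rewrite mulrDl addrCA lerD2l.
by rewrite [leRHS](splitr e) lerD.
Qed.

Lemma rep_lin c a b xi : closure U a -> closure U b ->
  rep (c *: a + b) xi = c *: rep a xi + rep b xi.
Proof.
move=> ca cb; apply/eqP; rewrite -subr_eq0; apply/eqP.
apply: (@eps_eq0 _ _ _ ((2 * (Num.sqrt (csq c) + 1)) * rnorm xi)) => e e0 _.
have [a' Ua aa] := closure_approx ca e0; have [b' Ub bb] := closure_approx cb e0.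
have s0 := sqrtr_ge0 (csq c); set s := Num.sqrt (csq c) in s0 *.
have cc : rnorm (c *: a + b - (c *: a' + b')) <= (s + 1) * e.
  rewrite opprD addrACA -scalerBr; apply: le_trans (rnormD _ _) _.
  by rewrite rnormZ mulrDl mul1r lerD // ler_wpM2l.
have h := le_trans (rep_approx xi (closure_lin (c := c) ca cb) (U_lin c Ua Ub))
  (ler_wpM2r (rnorm_ge0 xi) cc).
have ha := le_trans (rep_approx xi ca Ua) (ler_wpM2r (rnorm_ge0 xi) aa).
have hb := le_trans (rep_approx xi cb Ub) (ler_wpM2r (rnorm_ge0 xi) bb).
rewrite act_op_lin // in h.
have -> : rep (c *: a + b) xi - (c *: rep a xi + rep b xi) =
    (rep (c *: a + b) xi - (c *: act_op a' xi + act_op b' xi)) -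
    (c *: (rep a xi - act_op a' xi) + (rep b xi - act_op b' xi)).
  rewrite scalerBr addrACA -opprD.
  by rewrite opprB addrA subrK.
apply: le_trans (rnormD _ _) _; rewrite rnormN.
apply: (@le_trans _ _ ((s + 1) * e * rnorm xi + (s * (e * rnorm xi) + e * rnorm xi))).
  apply: lerD h _; apply: le_trans (rnormD _ _) _.
  by rewrite rnormZ lerD // ler_wpM2l.
by rewrite le_eqVlt; apply/orP; left; apply/eqP; ring.
Qed.

(** Multiplicativity holds for approximants a' and b' in the union. The three terms of the constant
    account for replacing ab by a'b', then a by a' at the vector [rep b xi], then b by b' under
    [act_op a']. *)
Lemma rep_mul a b xi : closure U a -> closure U b ->
  rep (amul a b) xi = rep a (rep b xi).
Proof.
move=> ca cb; apply/eqP; rewrite -subr_eq0; apply/eqP.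
pose K := rnorm b + rnorm a + 1.
apply: (@eps_eq0 _ _ _ (K * rnorm xi + rnorm (rep b xi) +
  (rnorm a + 1) * rnorm xi)) => e e0 e1.
have [a' Ua aa] := closure_approx ca e0; have [b' Ub bb] := closure_approx cb e0.
have h := le_trans (rep_approx xi (closure_mul ca cb) (U_mul Ua Ub))
  (ler_wpM2r (rnorm_ge0 xi) (rnorm_amulB aa bb e1)).
rewrite act_op_mul // in h.
have ha := le_trans (rep_approx (rep b xi) ca Ua) (ler_wpM2r (rnorm_ge0 _) aa).
have hb := le_trans (rep_approx xi cb Ub) (ler_wpM2r (rnorm_ge0 xi) bb).
have a'a : rnorm a' <= rnorm a + 1.
  rewrite -[a'](subrK a); apply: le_trans (rnormD _ _) _.
  by rewrite addrC lerD2l rnormB (le_trans aa).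
have hab : rnorm (act_op a' (rep b xi) - act_op a' (act_op b' xi)) <=
    (rnorm a + 1) * (e * rnorm xi).
  rewrite -linearB; apply: le_trans (act_op_le _ Ua) _.
  by rewrite ler_pM ?rnorm_ge0.
have -> : rep (amul a b) xi - rep a (rep b xi) =
    (rep (amul a b) xi - act_op a' (act_op b' xi)) -
    ((rep a (rep b xi) - act_op a' (rep b xi)) +
     (act_op a' (rep b xi) - act_op a' (act_op b' xi))).
  by rewrite addrA subrK opprB addrA subrK.
apply: le_trans (rnormD _ _) _; rewrite rnormN.
apply: (@le_trans _ _ (K * e * rnorm xi +
  (e * rnorm (rep b xi) + (rnorm a + 1) * (e * rnorm xi)))).
  by apply: lerD h _; apply: le_trans (rnormD _ _) _; rewrite lerD.
by rewrite le_eqVlt; apply/orP; left; apply/eqP; ring.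
Qed.

Lemma opnorm_le (T : H -> H) (K : R) : 0 <= K -> (forall xi, rnorm (T xi) <= K * rnorm xi) ->
  (opnorm T <= K%:E)%E.
Proof.
move=> K0 TK; apply: ge_ereal_sup => _ [xi /= xi1 <-]; rewrite lee_fin.
by apply: le_trans (TK xi) _; rewrite ler_piMr.
Qed.

Lemma rep_contractive : contractive (closure U) rep.
Proof.
by move=> a ca; apply: opnorm_le => [|xi]; [exact: rnorm_ge0|exact: rep_le].
Qed.

Lemma rep_is_representation : is_representation (closure U) rep.
Proof.
split=> [c a b xi ca cb|a b xi ca cb|]; first exact: rep_lin.
  exact: rep_mul.
by exists 1 => a ca; rewrite mul1r; apply: rep_contractive.
Qed.

Lemma csqRC (r : R) : csq r%:C%C = r ^+ 2.
Proof. by rewrite /csq /= expr0n addr0. Qed.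

Lemma opnorm_ge (T : {linear H -> H}) (c : R) xi : xi != 0 ->
  c * rnorm xi <= rnorm (T xi) -> (c%:E <= opnorm T)%E.
Proof.
move=> xi0 cT; have r0 : 0 < rnorm xi.
  by rewrite lt_def rnorm_ge0 andbT; apply: contraNneq xi0 => /rnorm_eq0 ->.
have rE : Num.sqrt (csq ((rnorm xi)^-1)%:C%C) = (rnorm xi)^-1.
  by rewrite csqRC sqrtr_sqr ger0_norm // invr_ge0 ltW.
apply: (@le_trans _ _ (rnorm (T (((rnorm xi)^-1)%:C%C *: xi)))%:E).
  by rewrite lee_fin linearZ rnormZ rE mulrC ler_pdivlMr.
apply: ereal_sup_ubound; exists (((rnorm xi)^-1)%:C%C *: xi) => //=.
by rewrite rnormZ rE mulVf // gt_eqF.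
Qed.

(** Pad f with zeros: the first [N 0] coordinates of the image are those of the level 0 matrix
    applied to f, and they already bound the norm below. *)
Lemma rep_lower a (c : R) (f : nat -> R[i]) : B 0 a -> 0 <= c ->
  c ^+ 2 * (\sum_(x < N 0) csq (f x)) < \sum_(x < N 0) csq (act 0 a f x) ->
  (c%:E <= opnorm (rep a))%E.
Proof.
move=> Ba c0 cf; pose g x := if (x < N 0)%N then f x else 0.
have gS m : sqsum g m <= \sum_(x < N 0) csq (f x).
  apply: le_trans (sqsum_mono g (leq_maxl m (N 0))) _.
  rewrite (sum_ord_if (fun x => csq (f x)) (leq_maxr m (N 0))).
  by apply: ler_sum => x _; rewrite /g; case: ifP => // _; rewrite csq0.
have [|eta etaE] := @l2_ext R index_set g _ _ gS.
  by move=> x nD; rewrite /g; case: ifP => // /index_set_N.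
have Ua : U a by exists 0%N.
have actE x : (x < N 0)%N -> rep a eta x = act 0 a f x.
  move=> xN; rewrite rep_act // (act_opE _ Ba) //; apply: eq_bigr => y _.
  by rewrite etaE /g ltn_ord.
have eta_le : rnorm eta ^+ 2 <= \sum_(x < N 0) csq (f x).
  rewrite l2_rnormE; apply: rsum_le => [|m]; first exact: sqsum_summable.
  by apply: le_trans (gS m); apply: ler_sum => x _; rewrite etaE.
have rep_ge : \sum_(x < N 0) csq (act 0 a f x) <= rnorm (rep a eta) ^+ 2.
  by apply: le_trans (sqsum_le_rnorm _ (N 0)); apply: ler_sum => x _; rewrite actE.
have h : (c * rnorm eta) ^+ 2 < rnorm (rep a eta) ^+ 2.
  rewrite exprMn; apply: le_lt_trans (lt_le_trans cf rep_ge).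
  by rewrite ler_wpM2l ?sqr_ge0.
apply: (@opnorm_ge _ _ eta).
  (* For eta = 0 the strict inequality [h] would read 0 < 0. *)
  by apply: contraTneq h => ->; rewrite linear0 !rnorm0 mulr0 ltxx.
by rewrite ltW // -ltr_sqr ?nnegrE ?mulr_ge0 ?rnorm_ge0.
Qed.

(** * Invariant subspaces *)

Hypothesis pt_lt : forall i x y, (x < N i)%N -> (y < N i)%N ->
  (pt i.+1 x < pt i.+1 y)%N = (pt i x < pt i y)%N.
Hypothesis pt_inj : forall i x y, (x < N i)%N -> (y < N i)%N ->
  pt i x = pt i y -> x = y.
Hypothesis M_lower : forall i a x y, B i a -> (x < N i)%N -> (y < N i)%N ->
  (pt i y < pt i x)%N -> M i a x y = 0.
Hypothesis M_unit : forall i x y, (x < N i)%N -> (y < N i)%N -> (pt i x <= pt i y)%N ->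
  exists e, [/\ B i e, rnorm e <= 1 & forall x' y', (x' < N i)%N -> (y' < N i)%N ->
    M i e x' y' = ((x' == x) && (y' == y))%:R].

(** One witnessing level suffices, since [pt_lt] makes comparisons independent of the level. *)
Definition prec x y : Prop :=
  exists i, [/\ (x < N i)%N, (y < N i)%N & (pt i x <= pt i y)%N].

Lemma pt_le_mono i j x y : (i <= j)%N -> (x < N i)%N -> (y < N i)%N ->
  (pt j x <= pt j y)%N = (pt i x <= pt i y)%N.
Proof.
move=> ij xN yN; elim: j ij => [|j IH]; first by rewrite leqn0 => /eqP->.
rewrite leq_eqVlt => /predU1P[->//|]; rewrite ltnS => ij.
by rewrite leqNgt pt_lt ?(leq_trans _ (N_mono ij)) // -leqNgt IH.
Qed.

Lemma prec_total x y : index_set x -> index_set y -> prec x y \/ prec y x.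
Proof.
move=> [i xi] [j yj]; have xm := leq_trans xi (N_mono (leq_maxl i j)).
have ym := leq_trans yj (N_mono (leq_maxr i j)).
by case/orP: (leq_total (pt (maxn i j) x) (pt (maxn i j) y)) => ?; [left|right];
   exists (maxn i j).
Qed.

Lemma prec_anti x y : prec x y -> prec y x -> x = y.
Proof.
move=> [i [xi yi xy]] [j [yj xj yx]].
have im := leq_maxl i j; have jm := leq_maxr i j.
apply: (@pt_inj (maxn i j)); first exact: leq_trans xi (N_mono im).
  exact: leq_trans yi (N_mono im).
by apply/eqP; rewrite eqn_leq (pt_le_mono im) // xy (pt_le_mono jm).
Qed.

Definition vanishing (P : set nat) : set H := [set xi | forall x, P x -> xi x = 0].

Lemma vanishing_closed P : closed_subspace (vanishing P).
Proof.
split=> [x _|c xi eta xi0 eta0 x Px|].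
- by rewrite l20E.
- by rewrite l2E xi0 // eta0 // mulr0 addr0.
apply/closed_rnormP => xi h x Px; apply/eqP; rewrite -csq_eq0.
have := csq_ge0 (xi x); rewrite le_eqVlt => /predU1P[<-//|c0].
have [|eta eta0] := h (Num.sqrt (csq (xi x))); first by rewrite sqrtr_gt0.
move=> lt; have := csq_le_rnorm (xi - eta) x.
rewrite l2DE l2NE eta0 // subr0 leNgt -[X in _ < X]sqr_sqrtr ?(ltW c0) //.
by rewrite ltr_sqr ?nnegrE ?rnorm_ge0 ?sqrtr_ge0 // lt.
Qed.

(** The matrices are upper triangular for [prec], so coordinate x of the image uses only coordinates
    above x, where xi vanishes as well; closedness extends this from the union to its closure. *)
Lemma vanishing_Lat P : (forall x y, P x -> prec x y -> P y) ->
  Lat (rep_image (closure U) rep) (vanishing P).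
Proof.
move=> Pup; split; first exact: vanishing_closed.
move=> _ [a ca <-] _ [xi xi0 <-].
have [_ _ /closed_rnormP clP] := vanishing_closed P; apply: clP => e e0.
have r1 : 0 < rnorm xi + 1 by rewrite ltr_wpDl ?rnorm_ge0.
have [b Ub ab] := closure_approx ca (divr_gt0 e0 r1).
exists (act_op b xi); last first.
  apply: le_lt_trans (rep_approx xi ca Ub) _.
  apply: le_lt_trans (ler_wpM2r (rnorm_ge0 xi) ab) _.
  by rewrite mulrAC ltr_pdivrMr // ltr_pM2l // ltrDl.
move=> x Px; have [[j xj]|nD] := pselect (index_set x); last by rewrite l2_supp.
case: Ub => i _ Bb; have xm := leq_trans xj (N_mono (leq_maxr i j)).
have Bm := B_mono (leq_maxl i j) Bb.
rewrite (act_opE _ Bm) // /act big1 // => y _.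
have [yx|xy] := ltnP (pt (maxn i j) y) (pt (maxn i j) x).
  by rewrite M_lower // mul0r.
by rewrite xi0 ?mulr0 //; apply: Pup Px _; exists (maxn i j).
Qed.

Lemma tail_lt xi (e : R) i0 : 0 < e ->
  exists2 i, (i0 <= i)%N & rnorm (xi - l2_trunc xi (N i)) < e.
Proof.
move=> e0; have [K xiK] := sqsum_approx xi e0; have [i i0i iP] := index_bound i0 K.
exists i => //; rewrite -ltr_sqr ?nnegrE ?rnorm_ge0 ?(ltW e0) //.
apply: le_lt_trans (rnorm_l2_trunc_le _ _) _; apply: le_lt_trans xiK.
rewrite lerD2l lerN2 /sqsum (sum_ord_if (fun x => csq (xi x)) (leq_maxl K (N i))).
rewrite (sum_ord_if (fun x => csq (xi x)) (leq_maxr K (N i))).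
apply: ler_sum => x _; case: ifP => xK; last by case: ifP => // _; apply: csq_ge0.
case: ifP => // /negbT xN; have [Dx|nD] := pselect (index_set x).
  by rewrite iP in xN.
by rewrite l2_supp // csq0.
Qed.

(** On the truncation of xi to level i, e acts exactly as the rank one matrix unit, by block
    diagonality. On the tail it is only known to be a contraction, which is the error allowed. *)
Lemma unit_approx i x y e xi : (x < N i)%N -> (y < N i)%N -> B i e -> rnorm e <= 1 ->
  (forall x' y', (x' < N i)%N -> (y' < N i)%N ->
    M i e x' y' = ((x' == x) && (y' == y))%:R) ->
  rnorm (act_op e xi - xi y *: l2_delta R index_set x) <=
  rnorm (xi - l2_trunc xi (N i)).
Proof.
move=> xN yN Be e1 eE; have Ue : U e by exists i.
have <- : act_op e (l2_trunc xi (N i)) = xi y *: l2_delta R index_set x.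
  apply: (act_op_ext Be) => j z ij zN; rewrite l2ZE l2_deltaE; last by exists i.
  rewrite /act; under eq_bigr => t _ do rewrite l2_truncE.
  rewrite (eq_bigr (fun t : 'I_(N j) => if (t < N i)%N then M j e z t * xi t else 0)).
    rewrite -(sum_ord_if (fun t => M j e z t * xi t) (N_mono ij)).
    have [zi|iz] := ltnP z (N i).
      rewrite (bigD1 (Ordinal yN)) //= big1 ?addr0 => [|t ty].
        by rewrite (M_mono ij) // eE // eqxx andbT mulrC.
      rewrite (M_mono ij) // eE // [_ == y](negPf ty) andbF mul0r //.
    rewrite big1 => [|t _]; last by rewrite (M_col_mono ij) ?mul0r ?iz.
    by have [zx|_] := eqVneq z x; rewrite ?mulr0 //; rewrite zx leqNgt xN in iz.
  by move=> t _; case: ifP => _; rewrite ?mulr0.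
rewrite -linearB; apply: le_trans (act_op_le _ Ue) _.
by rewrite ler_piMl ?rnorm_ge0.
Qed.

(** Units e_xy of higher and higher levels send xi to vectors of L tending to xi_y delta_x; divide
    by xi_y and use that L is closed. *)
Lemma Lat_delta L xi x y : Lat (rep_image (closure U) rep) L -> L xi -> xi y != 0 ->
  prec x y -> L (l2_delta R index_set x).
Proof.
move=> [[L0 Llin /closed_rnormP Lcl] Linv] Lxi xy0 [i0 [x0 y0 xy]].
apply: Lcl => e e0; pose s := Num.sqrt (csq (xi y)).
have s0 : 0 < s by rewrite sqrtr_gt0 lt_def csq_ge0 csq_eq0 xy0.
(* The tail is taken below s e because it will be divided by xi_y, of modulus s. *)
have [i i0i tl] := tail_lt xi i0 (mulr_gt0 s0 e0).
have xN := leq_trans x0 (N_mono i0i); have yN := leq_trans y0 (N_mono i0i).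
have [|u [Bu u1 uE]] := M_unit xN yN; first by rewrite (pt_le_mono i0i).
have Uu : U u by exists i.
exists ((xi y)^-1 *: act_op u xi).
  rewrite -[_ *: _]addr0; apply: Llin => //; rewrite -rep_act //.
  by apply: (Linv (rep u)); [exists u => //; exact: subset_closure|exists xi].
have -> : l2_delta R index_set x - (xi y)^-1 *: act_op u xi =
    (xi y)^-1 *: (xi y *: l2_delta R index_set x - act_op u xi).
  by rewrite scalerBr scalerA mulVf // scale1r.
rewrite rnormZ rnormB.
have -> : Num.sqrt (csq (xi y)^-1) = s^-1.
  rewrite -sqrtrV ?csq_ge0 //; congr Num.sqrt; apply: (mulfI (x := csq (xi y))).
    by rewrite csq_eq0.
  by rewrite -csqM !mulfV ?csq_eq0 ?csq1.
rewrite mulrC ltr_pdivrMr // mulrC.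
exact: le_lt_trans (unit_approx xi xN yN Bu u1 uE) tl.
Qed.

Lemma Lat_support L xi : closed_subspace L ->
  (forall x, xi x != 0 -> L (l2_delta R index_set x)) -> L xi.
Proof.
move=> [L0 Llin /closed_rnormP Lcl] h.
have Ltr n : L (l2_trunc xi n).
  elim: n => [|n IH].
    by rewrite (_ : l2_trunc xi 0 = 0) //; apply: l2P => x; rewrite l2_truncE.
  have [xn|xn] := eqVneq (xi n) 0.
    rewrite (_ : l2_trunc xi n.+1 = l2_trunc xi n) //; apply: l2P => x.
    rewrite !l2_truncE ltnS leq_eqVlt; have [->|_] := eqVneq x n => //=.
    by rewrite xn ltnn.
  have Dn : index_set n by apply: contrapT => nD; rewrite l2_supp ?eqxx in xn.
  rewrite (_ : l2_trunc xi n.+1 = xi n *: l2_delta R index_set n + l2_trunc xi n).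
    by apply: Llin => //; apply: h.
  apply: l2P => x; rewrite l2E l2_deltaE // !l2_truncE ltnS leq_eqVlt.
  have [->|_] := eqVneq x n => /=; first by rewrite ltnn mulr1 addr0.
  by rewrite mulr0 add0r.
by apply: Lcl => e e0; have [i _ tl] := tail_lt xi 0 e0; exists (l2_trunc xi (N i)).
Qed.

(** If xi lies in L1 but not in L2, some delta_x with xi_x nonzero is not in L2. By [Lat_delta] no
    vector of L2 has support at or above x, so its support lies below x, where L1 contains all basis
    vectors. *)
Lemma Lat_chain : is_chain (Lat (rep_image (closure U) rep)).
Proof.
move=> L1 L2 L1L L2L; have [L12|] := pselect (L1 `<=` L2); first by left.
move=> /existsNP[xi /not_implyP[L1xi nL2]]; right=> eta L2eta.
have [x xx0 nLx] : exists2 x, xi x != 0 & ~ L2 (l2_delta R index_set x).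
  apply: contrapT => /forall2NP h; apply: nL2; apply: Lat_support; first by case: L2L.
  by move=> x x0; case: (h x) => [/(_ x0)//|/contrapT].
have Dx : index_set x by apply: contrapT => nD; rewrite l2_supp ?eqxx in xx0.
apply: Lat_support; first by case: L1L.
move=> y y0; have Dy : index_set y by apply: contrapT => nD; rewrite l2_supp ?eqxx in y0.
have [xy|yx] := prec_total Dx Dy; last exact: Lat_delta L1L L1xi xx0 yx.
by case: nLx; apply: Lat_delta L2L L2eta y0 xy.
Qed.

(** * The extreme invariant subspaces and the rank one operator *)

Section Essential.
Variable last : nat.
Hypothesis last_lt : (last < N 0)%N.
Hypothesis pt_first : forall i x, (x < N i)%N -> (pt i 0 <= pt i x)%N.
Hypothesis pt_last : forall i x, (x < N i)%N -> (pt i x <= pt i last)%N.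
Hypothesis M_corner : exists2 e, B 0 e & forall i x y, (x < N i)%N -> (y < N i)%N ->
  M i e x y = ((x == 0%N) && (y == last))%:R.
Local Notation L := (Lat (rep_image (closure U) rep)).
Local Notation delta := (l2_delta R index_set).

Let D0 : index_set 0. Proof. by exists 0%N. Qed.
Let Dlast : index_set last. Proof. by exists 0%N. Qed.

Let lastN i : (last < N i)%N.
Proof. exact: leq_trans last_lt (N_mono (leq0n i)). Qed.

Let N_gt i : (0 < N i)%N.
Proof. exact: leq_trans N_gt0 (N_mono (leq0n i)). Qed.

Lemma prec_first x : index_set x -> prec 0 x.
Proof. by case=> i xi; exists i; split; rewrite ?pt_first. Qed.

Lemma prec_last x : index_set x -> prec x last.
Proof. by case=> i xi; exists i; split; rewrite ?pt_last. Qed.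

Lemma line_delta y : index_set y -> line (delta y) = vanishing [set x | x <> y].
Proof.
move=> Dy; apply/seteqP; split=> [_ [c _ <-] x xy|xi xi0 /=].
  by rewrite l2ZE l2_deltaE //; case: eqP xy; rewrite ?mulr0.
exists (xi y) => //; apply: l2P => x; rewrite l2ZE l2_deltaE //.
by have [->|/eqP xy] := eqVneq x y; rewrite ?mulr1 // mulr0 xi0.
Qed.

Lemma prec_index x y : prec x y -> index_set x /\ index_set y.
Proof. by case=> i [xi yi _]; split; exists i. Qed.

Lemma line_first_Lat : L (line (delta 0)).
Proof.
rewrite line_delta //; apply: vanishing_Lat => x y /= x0 xy y0; apply: x0.
by apply: prec_anti; [rewrite y0 in xy|apply: prec_first; case: (prec_index xy)].
Qed.

Lemma vanishing_last_Lat : L (vanishing [set last]).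
Proof.
apply: vanishing_Lat => x y /= -> ly; apply: prec_anti => //.
by apply: prec_last; case: (prec_index ly).
Qed.

Lemma delta_neq0 y : index_set y -> delta y != 0.
Proof.
move=> Dy; apply/eqP => d0; have := l2_deltaE R y Dy.
by rewrite d0 l20E eqxx => /eqP; rewrite eq_sym oner_eq0.
Qed.

Lemma coord_neq0 xi : xi != 0 -> exists2 x, xi x != 0 & index_set x.
Proof.
move=> xi0; have [x xx] : exists x, xi x != 0.
  apply: contrapT => /forallNP h; move/eqP: xi0; apply; apply: l2P => x.
  by apply/eqP/negPn/negP/h.
by exists x => //; apply: contrapT => nD; rewrite l2_supp ?eqxx in xx.
Qed.

Lemma Lat_line_sub K : L K -> K <> [set 0] -> line (delta 0) `<=` K.
Proof.
move=> LK K0; have [xi Kxi xi0] : exists2 xi, K xi & xi != 0.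
  apply: contrapT => /forall2NP h; apply: K0; apply/seteqP; split=> [xi Kxi|_ ->].
    by case: (h xi) => // /negP/negPn/eqP ->.
  by case: LK => [[]].
have [x x0 Dx] := coord_neq0 xi0.
have Kd := Lat_delta LK Kxi x0 (prec_first Dx).
move=> _ [c _ <-]; rewrite -[_ *: _]addr0.
by case: LK => [[K00 Klin _] _]; apply: Klin.
Qed.

Lemma zero_plusE : zero_plus L = line (delta 0).
Proof.
have neq : line (delta 0) <> [set 0].
  move=> e; have /eqP := delta_neq0 D0; apply.
  suff : [set 0] (delta 0) by [].
  by rewrite -e; exists 1; rewrite ?scale1r.
apply: xget_unique.
  split=> [||K LK K0 Ks]; [exact: line_first_Lat|exact: neq|].
  by apply/seteqP; split=> //; apply: Lat_line_sub.
move=> K [LK K0 Kmin]; apply/esym; apply: Kmin => //; first exact: line_first_Lat.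
exact: Lat_line_sub.
Qed.

(** A vector with nonzero last coordinate generates every basis vector, hence the whole space. *)
Lemma Lat_sub_vanishing K : L K -> K <> [set: H] -> K `<=` vanishing [set last].
Proof.
move=> LK KT xi Kxi _ /= ->; apply/eqP/negPn/negP => xl; apply: KT.
apply/seteqP; split=> // eta _; apply: Lat_support; first by case: LK.
move=> y y0; apply: Lat_delta LK Kxi xl _; apply: prec_last.
by apply: contrapT => nD; rewrite l2_supp ?eqxx in y0.
Qed.

Lemma I_minusE : I_minus L = vanishing [set last].
Proof.
have neq : vanishing [set last] <> [set: H].
  move=> e; have : vanishing [set last] (delta last) by rewrite e.
  by move=> /(_ last erefl)/eqP; rewrite l2_deltaE // eqxx oner_eq0.
apply: xget_unique.
  split=> [||K LK KT]; [exact: vanishing_last_Lat|exact: neq|].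
  exact: Lat_sub_vanishing.
move=> K [LK KT Kmax]; apply/seteqP; split; first exact: Lat_sub_vanishing.
by apply: Kmax => //; exact: vanishing_last_Lat.
Qed.

Lemma orthocompl_vanishing : orthocompl (vanishing [set last]) = line (delta last).
Proof.
rewrite line_delta //; apply/seteqP; split=> [xi h x /= xl|xi xi0 eta eta0].
  have [Dx|nD] := pselect (index_set x); last by rewrite l2_supp.
  rewrite -(hdot_delta xi Dx); apply: h => _ /= ->.
  by rewrite l2_deltaE // eq_sym; case: eqP.
rewrite l2_hdotE /csum; apply/eqP; rewrite eq_complex /=.
have h x : xi x * Num.conj (eta x) = 0.
  have [->|/eqP xl] := eqVneq x last; first by rewrite eta0 // conjC0 mulr0.
  by rewrite xi0 // mul0r.
by rewrite !(@rsum_single _ 0) ?h ?eqxx // => x _; rewrite h.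
Qed.

(** One fixed e has the rank one matrix at every level, unlike the units of [M_unit], which are
    controlled at a single level. So the operator is attained exactly and not just as a strong
    limit. *)
Lemma rank_one_rep : rep_image (closure U) rep (rank_one (delta 0) (delta last)).
Proof.
have [e Be eE] := M_corner; have Ue : U e by exists 0%N.
exists e; first exact: subset_closure.
apply/funext => xi; rewrite rep_act // /rank_one hdot_delta //.
apply: (act_op_ext Be) => j x _ xN; rewrite l2ZE l2_deltaE // /act.
rewrite (bigD1 (Ordinal (lastN j))) //= big1 ?addr0 => [|y yl].
  by rewrite eE // eqxx andbT mulrC.
by rewrite eE // [_ == last](negPf yl) andbF mul0r.
Qed.

Lemma rep_essential : essential_nest_representation (closure U) rep.
Proof.
split; first by split; [exact: rep_is_representation|exact: Lat_chain].
exists (delta 0), (delta last); split.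
- exact: delta_neq0.
- exact: delta_neq0.
- exact: zero_plusE.
- by rewrite I_minusE orthocompl_vanishing.
- exact: rank_one_rep.
Qed.

Lemma compression_rep : exists (H : hilbertType R) (rho : A -> {linear H -> H}),
  [/\ essential_nest_representation (closure U) rho, contractive (closure U) rho &
    forall a (c : R) (f : nat -> R[i]), B 0 a -> 0 <= c ->
      c ^+ 2 * (\sum_(x < N 0) csq (f x)) < \sum_(x < N 0) csq (act 0 a f x) ->
      (c%:E <= opnorm (rho a))%E].
Proof.
exists H, rep; split; [exact: rep_essential|exact: rep_contractive|].
exact: rep_lower.
Qed.

End Essential.
End CompressionSystem.

(** * The norm formula *)

Section FiniteLevels.
Variables (R : realType) (k : nat) (n : 'I_k.+1 -> nat).

Lemma upper_triangular_lin (c : R[i]) (x y : fdalg R n) : upper_triangular x ->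
  upper_triangular y -> upper_triangular (c *: x + y).
Proof.
move=> xU yU j p q qp; rewrite -entryE entryD entryZ !entryE xU // yU //.
by rewrite mulr0 addr0.
Qed.

Lemma upper_triangular_mul (x y : fdalg R n) : upper_triangular x ->
  upper_triangular y -> upper_triangular (amul x y).
Proof.
move=> xU yU j p q qp; rewrite -entryE entryM big1 // => t _; rewrite !entryE.
have [tp|pt] := ltnP t p; first by rewrite xU // mul0r.
by rewrite yU ?mulr0 // (leq_trans qp).
Qed.

(** For a diagonal unit the C*-identity reads r = r^2; for a general unit e, e* e is a diagonal
    unit. *)
Lemma rnorm_munit_le1 (A : cstarAlgType R) (psi : {linear fdalg R n -> A}) u :
  star_hom psi -> rnorm (psi (munit R u)) <= 1.
Proof.
move=> [psiM psiS].
have idem j (q : 'I_(n j).+1) : rnorm (psi (munit R (muidx q q))) <= 1.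
  have := rnorm_cstar (psi (munit R (muidx q q))).
  rewrite -psiS -psiM munit_star munitM; set r := rnorm _ => r2.
  have r0 : 0 <= r by apply: rnorm_ge0.
  by rewrite leNgt; apply/negP => r1; nra.
elim/muidx_ind: u => j p q; have := idem j q.
rewrite -(munitM R q p q) psiM (_ : muidx q p = flip (muidx p q)) //.
rewrite -munit_star psiS rnorm_cstar => h.
by rewrite -(@ler_pXn2r _ 2) ?nnegrE ?rnorm_ge0 // expr1n.
Qed.

End FiniteLevels.

Section LevelZero.
Variables (R : realType) (k : nat -> nat) (n : forall i, 'I_(k i).+1 -> nat).
Arguments n : clear implicits.
Variable phi : forall i, {linear fdalg R (n i) -> fdalg R (n i.+1)}.
Hypothesis phi_emb : forall i, TAF_embedding (phi i).
Variables (A : cstarAlgType R) (psi : forall i, {linear fdalg R (n i) -> A}).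
Hypotheses (psi_hom : forall i, star_hom (psi i)).
Hypotheses (psi_inj : forall i, injective (psi i)).
Hypotheses (psi_phi : forall i x, psi i.+1 (phi i x) = psi i x).

Definition level i : set A := psi i @` @upper_triangular R (k i) (n i).

Lemma level_sub i : level i `<=` level i.+1.
Proof.
move=> _ [x xU <-]; exists (phi i x); last exact: psi_phi.
by case: (phi_emb i) => _ _ phiU _; apply: phiU; exists x.
Qed.

Lemma level_lin i (c : R[i]) a b : level i a -> level i b -> level i (c *: a + b).
Proof.
move=> [x xU <-] [y yU <-]; exists (c *: x + y); last by rewrite linearP.
exact: upper_triangular_lin.
Qed.

Lemma level_mul i a b : level i a -> level i b -> level i (amul a b).
Proof.
move=> [x xU <-] [y yU <-]; exists (amul x y); last by case: (psi_hom i) => ->.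
exact: upper_triangular_mul.
Qed.

(** The abstract compression system takes matrices of elements of [A], so level i matrices are
    recovered through the injective [psi i]. *)
Definition preimage_of i (a : A) : fdalg R (n i) := xget 0 [set x | psi i x = a].

Lemma preimage_ofK i x : preimage_of i (psi i x) = x.
Proof. by apply: xget_unique => // y /psi_inj. Qed.

Lemma psi_corner_image (j : 'I_(k 0).+1) i :
  psi i (corner_image phi j i) = psi 0 (munit R (corner n j)).
Proof. by elim: i => //= i <-; rewrite psi_phi. Qed.

Section Path.
Variables (j : 'I_(k 0).+1) (w : forall i, munit_idx (n i)).
Hypothesis w_min : forall i, minimal_entry phi j (w i).
Hypothesis w_sub : forall i, summand (phi i) (w i) (w i.+1).
Local Notation N := (npoints phi w).

(** At level 0 the corner image is a single matrix unit with one nonzero entry. The initial interval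
    is thus the entire summand. *)
Lemma path_corner : w 0 = corner n j.
Proof.
have [+ _] := w_min 0; rewrite /= (entry_munit R (corner n j) (w 0)).
by rewrite pnatr_eq0 eqb0 negbK => /eqP.
Qed.

Let w0_le : ((tagged (w 0)).1 <= (tagged (w 0)).2)%N.
Proof. by rewrite path_corner. Qed.

Lemma path_entry i : entry (corner_image phi j i) (w i) = 1.
Proof.
elim: i => [|i IH] /=.
  by rewrite (entry_munit R (corner n j) (w 0)) path_corner eqxx.
by rewrite (entry_f (phi_emb i) _ (w_sub i)).
Qed.

(** Any nonzero entry within the interval must, by minimality, sit at its two ends, which have the
    indices 0 and [(N 0).-1] at every level. *)
Lemma compression_corner i x y : (x < N i)%N -> (y < N i)%N ->
  compression phi w (corner_image phi j i) x y =
  ((x == 0%N) && (y == (N 0).-1))%:R.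
Proof.
move=> xN yN; have N0i := npoints0_le phi w i.
have lastN : ((N 0).-1 < N i)%N by rewrite prednK // npoints_gt0.
have firstE := place_first phi_emb w_sub i.
have lastE := place_last phi_emb w_sub w0_le i.
have [/andP[/eqP-> /eqP->]|xy] := boolP (_ && _).
  rewrite /compression firstE lastE !inord_val.
  transitivity (entry (corner_image phi j i) (w i)); last exact: path_entry.
  by case: (w i) => ? [].
apply/eqP/negPn/negP => xy0; have [_ /(_ _ _ xy0)] := w_min i.
have /andP[px qx] := placeP phi_emb w_sub w0_le xN.
have /andP[py qy] := placeP phi_emb w_sub w0_le yN.
rewrite !(place_inord phi_emb w_sub w0_le) // => /(_ px qy)[/(congr1 val) xE /(congr1 val) yE].
move: xE yE; rewrite /= !(place_inord phi_emb w_sub w0_le) // -firstE -lastE.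
move=> /(place_inj phi_emb w_sub w0_le xN (npoints_gt0 _ _ _)) x0.
move=> /(place_inj phi_emb w_sub w0_le yN lastN) yl.
by rewrite x0 yl !eqxx in xy.
Qed.

Definition path_matrix i (a : A) := compression phi w (preimage_of i a).

Lemma path_matrixE i x : path_matrix i (psi i x) = compression phi w x.
Proof. by rewrite /path_matrix preimage_ofK. Qed.

Lemma path_matrixS i x : path_matrix i.+1 (psi i x) = compression phi w (phi i x).
Proof. by rewrite -psi_phi path_matrixE. Qed.

Lemma path_rep : exists (H : hilbertType R) (rho : A -> {linear H -> H}),
  [/\ essential_nest_representation (TAF_algebra psi) rho,
      contractive (TAF_algebra psi) rho &
    forall a (c : R) (f : nat -> R[i]), level 0 a -> 0 <= c ->
      c ^+ 2 * (\sum_(x < N 0) csq (f x)) <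
        \sum_(x < N 0) csq (act N path_matrix 0 a f x) ->
      (c%:E <= opnorm (rho a))%E].
Proof.
apply: (@compression_rep R A N level path_matrix (place phi w)
  _ _ _ _ _ _ _ _ _ _ _ _ _ _ _ (N 0).-1).
- by move=> i; apply: npoints_le.
- exact: npoints_gt0.
- exact: level_sub.
- exact: level_lin.
- exact: level_mul.
- move=> i c _ _ x y [a _ <-] [b _ <-]; rewrite -linearP !path_matrixE.
  by rewrite /compression entryD entryZ.
- move=> i _ _ x y [a aU <-] [b bU <-] xN yN.
  by case: (psi_hom i) => <- _; rewrite !path_matrixE (compressionM phi_emb).
- move=> i _ x y [a aU <-] xN yN.
  by rewrite path_matrixS ?path_matrixE (compression_phi phi_emb).
- move=> i _ x y [a aU <-] xN yN.
  by rewrite path_matrixS ?path_matrixE (compression_phi_row phi_emb).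
- move=> i _ x y [a aU <-] xN yN.
  by rewrite path_matrixS ?path_matrixE (compression_phi_col phi_emb).
- move=> i _ f [a aU <-]; rewrite path_matrixE.
  exact: compression_contractive.
- by move=> i x y xN yN; apply: place_ltS.
- by move=> i x y xN yN; apply: place_inj.
- move=> i _ x y [a aU <-] xN yN xy; rewrite path_matrixE.
  by rewrite (compression_lower phi_emb).
- move=> i x y xN yN xy.
  have [u uU uE] := compression_munit phi_emb w_sub w0_le xN yN xy.
  exists (psi i (munit R u)); split; [by exists (munit R u)|exact: rnorm_munit_le1|].
  by move=> x' y' xN' yN'; rewrite path_matrixE uE.
- by rewrite prednK // npoints_gt0.
- move=> i x xN; rewrite (place_first phi_emb w_sub).
  by have /andP[] := placeP phi_emb w_sub w0_le xN.
- move=> i x xN; rewrite (place_last phi_emb w_sub w0_le).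
  by have /andP[] := placeP phi_emb w_sub w0_le xN.
- exists (psi 0 (munit R (corner n j))).
    by exists (munit R (corner n j)) => //; apply: munit_upper.
  move=> i x y xN yN; rewrite -(psi_corner_image j i) path_matrixE.
  exact: compression_corner.
Qed.

(** The level 0 interval exhausts the summand, so compressing there merely renumbers the
    coordinates. *)
Lemma path_act x (v : 'cV[R[i]]_(n 0 (tag (w 0))).+1) :
  let f a := v (inord (place phi w 0 a)) 0 in
  \sum_(a < N 0) csq (f a) = csqv v /\
  \sum_(a < N 0) csq (act N path_matrix 0 (psi 0 x) f a) =
    csqv (x (tag (w 0)) *m v).
Proof.
have all_in (t : 'I_(n 0 (tag (w 0))).+1) :
    ~~ ((tagged (w 0)).1 <= t <= (tagged (w 0)).2)%N -> False.
  have p0 : (tagged (w 0)).1 = 0%N :> nat by rewrite path_corner.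
  have q0 : (tagged (w 0)).2 = n 0%N (tag (w 0)) :> nat by rewrite path_corner.
  by rewrite p0 q0 leq0n -ltnS ltn_ord.
move=> f; split; rewrite /csqv.
  by rewrite (sum_points phi_emb w_sub w0_le) // => t /all_in.
rewrite (sum_points phi_emb w_sub w0_le) => [|t /all_in//].
apply: eq_bigr => a _; rewrite mxE (sum_points phi_emb w_sub w0_le) => [|t /all_in//].
by rewrite /act path_matrixE.
Qed.

End Path.

Lemma level0_rep (j : 'I_(k 0).+1) :
  exists (H : hilbertType R) (rho : A -> {linear H -> H}),
  [/\ essential_nest_representation (TAF_algebra psi) rho,
      contractive (TAF_algebra psi) rho &
      forall x (c : R) (v : 'cV[R[i]]_(n 0 j).+1), upper_triangular x -> 0 <= c ->
        c ^+ 2 * csqv v < csqv (x j *m v) -> (c%:E <= opnorm (rho (psi 0 x)))%E].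
Proof.
have [w wP] := minimal_path phi_emb j.
have w_min i : minimal_entry phi j (w i) by have [] := wP i.
have w_sub i : summand (phi i) (w i) (w i.+1) by have [] := wP i.
have [H [rho [rho_ess rho_con rhoP]]] := path_rep w_min w_sub.
exists H, rho; split=> // x c v xU c0.
suff h (v' : 'cV[R[i]]_(n 0 (tag (w 0))).+1) :
    c ^+ 2 * csqv v' < csqv (x (tag (w 0)) *m v') -> (c%:E <= opnorm (rho (psi 0 x)))%E.
  by move: v; have -> : j = tag (w 0) by rewrite (path_corner w_min).
have [fE actE] := path_act w_min w_sub x v'; rewrite -fE -actE.
by apply: rhoP => //; exists x.
Qed.

(** By [rnorm_le_csqv] some summand of x stretches a vector by more than c; the representation is
    built from that summand. *)
Lemma level0_norm x (c : R) : upper_triangular x -> 0 <= c -> c < rnorm (psi 0 x) ->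
  exists (H : hilbertType R) (rho : A -> {linear H -> H}),
  [/\ essential_nest_representation (TAF_algebra psi) rho,
      contractive (TAF_algebra psi) rho & (c%:E <= opnorm (rho (psi 0 x)))%E].
Proof.
move=> xU c0 cx.
have [j [v cv]] : exists j (v : 'cV[R[i]]_(n 0 j).+1), c ^+ 2 * csqv v < csqv (x j *m v).
  apply: contrapT => /forallNP h; move: cx; apply/negP; rewrite -leNgt.
  apply: (rnorm_le_csqv (psi_hom 0)) => // j v; rewrite leNgt; apply/negP => cv.
  by apply: (h j); exists v.
have [H [rho [rho_ess rho_con rhoP]]] := level0_rep j.
by exists H, rho; split=> //; apply: rhoP cv.
Qed.

End LevelZero.

(** * From level zero to the whole algebra *)

Section NormFormula.
Variables (R : realType) (k : nat -> nat) (n : forall i, 'I_(k i).+1 -> nat).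
Arguments n : clear implicits.
Variable phi : forall i, {linear fdalg R (n i) -> fdalg R (n i.+1)}.
Hypothesis phi_emb : forall i, TAF_embedding (phi i).
Variables (A : cstarAlgType R) (psi : forall i, {linear fdalg R (n i) -> A}).
Hypotheses (psi_hom : forall i, star_hom (psi i)).
Hypotheses (psi_inj : forall i, injective (psi i)).
Hypotheses (psi_phi : forall i x, psi i.+1 (phi i x) = psi i x).
Local Notation T := (TAF_algebra psi).

Lemma level_mono i j : (i <= j)%N -> level psi i `<=` level psi j.
Proof.
elim: j => [|j IH]; first by rewrite leqn0 => /eqP->.
rewrite leq_eqVlt => /predU1P[->//|]; rewrite ltnS => /IH ij.
exact: subset_trans ij (level_sub phi_emb psi_phi (i := j)).
Qed.

Lemma TAF_shift m : TAF_algebra (fun i => psi (i + m)) = T.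
Proof.
congr closure; apply/seteqP; split=> [a [i _ ai]|a [i _ ai]].
  by exists (i + m)%N.
by exists i => //; apply: (level_mono (leq_addr m i)).
Qed.

Lemma level_norm m x (c : R) : upper_triangular x -> 0 <= c -> c < rnorm (psi m x) ->
  exists (H : hilbertType R) (rho : A -> {linear H -> H}),
  [/\ essential_nest_representation T rho, contractive T rho &
      (c%:E <= opnorm (rho (psi m x)))%E].
Proof.
rewrite -(TAF_shift m).
exact: (@level0_norm R (fun i => k (i + m)) (fun i => n (i + m)%N)
  (fun i => phi (i + m)) (fun i => phi_emb (i + m)) A (fun i => psi (i + m))
  (fun i => psi_hom (i + m)) (fun i => @psi_inj (i + m)%N)
  (fun i => psi_phi (i := (i + m)%N))).
Qed.

Lemma TAF_subB a b : T a -> T b -> T (a - b).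
Proof.
move=> Ta Tb; rewrite addrC -scaleN1r.
exact: (closure_lin (B := level psi) (level_sub phi_emb psi_phi) (level_lin (psi := psi))).
Qed.

Lemma opnorm_ge0 (H : hilbertType R) (S : {linear H -> H}) : (0 <= opnorm S)%E.
Proof.
by apply: ereal_sup_ubound; exists 0; rewrite /= ?linear0 rnorm0.
Qed.

Lemma opnorm_perturb (H : hilbertType R) (rho : A -> {linear H -> H}) a b (e : R) :
  is_representation T rho -> contractive T rho -> T a -> T b -> rnorm (a - b) <= e ->
  (opnorm (rho b) <= opnorm (rho a) + e%:E)%E.
Proof.
move=> [rho_lin _ _] rho_con Ta Tb abe.
apply: ge_ereal_sup => _ [xi /= xi1 <-].
have Tab := TAF_subB Ta Tb.
have rE : rho b xi = rho a xi - rho (a - b) xi.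
  rewrite addrC -scaleN1r -rho_lin // scaleN1r opprB subrK //.
have h1 : ((rnorm (rho a xi))%:E <= opnorm (rho a))%E.
  by apply: ereal_sup_ubound; exists xi.
have h2 : ((rnorm (rho (a - b) xi))%:E <= e%:E)%E.
  apply: (@le_trans _ _ (opnorm (rho (a - b)))).
    by apply: ereal_sup_ubound; exists xi.
  by apply: le_trans (rho_con _ Tab) _; rewrite lee_fin.
apply: le_trans (leeD h1 h2); rewrite -EFinD lee_fin rE.
by apply: le_trans (rnormD _ _) _; rewrite rnormN.
Qed.

End NormFormula.

Theorem theorem2p10 (R : realType) (k : nat -> nat)
    (n : forall i, 'I_(k i).+1 -> nat)
    (phi : forall i, {linear fdalg R (n i) -> fdalg R (n i.+1)})
    (phi_emb : forall i, TAF_embedding (phi i))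
    (A : cstarAlgType R) (psi : forall i, {linear fdalg R (n i) -> A})
    (A_lim : is_AF_limit phi psi)
    (a : A) (a_in : TAF_algebra psi a) :
  (rnorm a)%:E =
  ereal_sup [set r : \bar R |
    exists (H : hilbertType R) (rho : A -> {linear H -> H}),
      [/\ essential_nest_representation (TAF_algebra psi) rho,
          contractive (TAF_algebra psi) rho &
          r = opnorm (rho a)]].
Proof.
have [psi_hom psi_inj psi_phi _] := A_lim.
set S := [set r | _]; apply/eqP; rewrite eq_le; apply/andP; split; last first.
  by apply: ge_ereal_sup => _ [H [rho [_ rho_con ->]]]; apply: rho_con.
have le_sup (H : hilbertType R) (rho : A -> {linear H -> H}) :
    essential_nest_representation (TAF_algebra psi) rho ->
    contractive (TAF_algebra psi) rho -> (opnorm (rho a) <= ereal_sup S)%E.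
  by move=> rho_ess rho_con; apply: ereal_sup_ubound; exists H, rho.
have sup_ge0 : (0 <= ereal_sup S)%E.
  (* Any summand of level 0 gives a representation, so the supremum is not over the empty set. *)
  have [H [rho [rho_ess rho_con _]]] := level0_rep phi_emb psi_hom psi_inj psi_phi ord0.
  exact: le_trans (opnorm_ge0 _) (le_sup _ _ rho_ess rho_con).
apply/lee_addgt0Pr => e e0.
(* One third each for passing from a to b, for the gap below ||b||, and for returning from b to a
   under the representation. *)
pose d := e / 3; have d0 : 0 < d by rewrite divr_gt0.
have /closure_rnormP/(_ _ d0)[b [m _ [x xU bE]] ab] := a_in.
have a_le : rnorm a <= rnorm b + d.
  rewrite -[a](subrK b) addrC; apply: le_trans (rnormD _ _) _.
  by rewrite lerD2l ltW.
have ddd : d + d + d = e by rewrite /d; field.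
(* For ||b|| <= d the constant ||b|| - d is not positive; then ||a|| <= 2 d <= e, and nonnegativity
   of the supremum is enough. *)
have [bd|bd] := lerP (rnorm b) d.
  apply: (@le_trans _ _ e%:E); last by rewrite leeDr.
  rewrite lee_fin (le_trans a_le) // -ddd.
  by apply: (@le_trans _ _ (d + d)); rewrite ?lerD2r // lerDl ltW.
have [||H [rho [rho_ess rho_con]]] :=
    level_norm phi_emb psi_hom psi_inj psi_phi (m := m) (x := x) (c := rnorm b - d) xU.
- by rewrite subr_ge0 ltW.
- by rewrite bE ltrBlDr ltrDl.
rewrite bE => c_le.
have Tb : TAF_algebra psi b by apply: subset_closure; exists m => //; exists x.
have [[rho_rep _] _] := rho_ess.
have b_le := opnorm_perturb phi_emb psi_phi rho_rep rho_con a_in Tb (ltW ab).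
have h : ((rnorm b - d)%:E <= ereal_sup S + d%:E)%E.
  by apply: le_trans c_le (le_trans b_le _); rewrite leeD2r // le_sup.
have -> : e%:E = (d%:E + (d%:E + d%:E))%E by rewrite -!EFinD addrA ddd.
rewrite addeA; apply: le_trans (leeD2r _ h).
by rewrite -!EFinD lee_fin (le_trans a_le) // addrA subrK.
Qed.
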